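(* Let $\mathbf{u}^0:\mathbb{R}^N\to\mathbb{R}^m$ be bounded and Lipschitz continuous, and let $\mathbf{u}=(u_1,\dots,u_m)$ be the solution of $$\partial_t u_i+H_i(x,D_xu_i)+\big(B\mathbf{u}(t,x)\big)_i=0\quad\text{in }(0,+\infty)\times\mathbb{R}^N,\qquad i\in\{1,\dots,m\},$$ with $\mathbf{u}(0,\cdot)=\mathbf{u}^0$. Assume that the Hamiltonians $H_1,\dots,H_m$ satisfy the standing assumptions listed in the context and, in addition, are of class $C^2$ in $\mathbb{R}^N\times\mathbb{R}^N$ with positive definite Hessian with respect to $p$. Then, for any fixed $t>0$, the function $\mathbf{u}(t,\cdot)$ is locally semiconcave with linear modulus on $\mathbb{R}^N$ (i.e. each component $u_i(t,\cdot)$ is).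
   Context: $N,m\ge 1$ are integers, $\mathbb{R}_+=[0,+\infty)$. Standing assumptions on $H_1,\dots,H_m:\mathbb{R}^N\times\mathbb{R}^N\to\mathbb{R}$: each $H_i$ is uniformly continuous on $\mathbb{R}^N\times B_R$ for every $R>0$ ($B_R$ the open ball of radius $R$ centred at $0$); there are superlinear functions $\alpha,\beta:\mathbb{R}_+\to\mathbb{R}$ (i.e. $\alpha(h)/h\to+\infty$, $\beta(h)/h\to+\infty$ as $h\to+\infty$) with $\alpha(|p|)\le H_i(x,p)\le\beta(|p|)$ for all $(x,p)$; $p\mapsto H_i(x,p)$ is strictly convex for every $x$; $H_i\in C^1(\mathbb{R}^N\times\mathbb{R}^N)$. $B=(b_{ij})$ is a real $m\times m$ matrix with $b_{ij}\le 0$ for $j\ne i$ and $\sum_{j}b_{ij}=0$ for every $i$; $(B\mathbf{u})_i=\sum_jb_{ij}u_j$. Solutions are in the viscosity sense: a continuous $\mathbf{u}$ is a solution if, for all $(t,x)\in(0,+\infty)\times\mathbb{R}^N$ and all $i$, $\partial_t\phi(t,x)+H_i(x,D_x\phi(t,x))+(B\mathbf{u}(t,x))_i\le0$ (resp. $\ge0$) for every $\phi$ of class $C^1$ near $(t,x)$ such that $u_i-\phi$ has a local maximum (resp. minimum) at $(t,x)$. The solution meant is the unique one with $\mathbf{u}(0,\cdot)=\mathbf{u}^0$ that is bounded and uniformly continuous on $[0,T]\times\mathbb{R}^N$ for every $T>0$ (it is Lipschitz continuous on each $[0,T]\times\mathbb{R}^N$). Given an open convex set $U\subset\mathbb{R}^N$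 and $C>0$, $f:U\to\mathbb{R}$ is semiconcave with semiconcavity constant $C$ (linear modulus) if $f(\lambda x+(1-\lambda)y)\ge\lambda f(x)+(1-\lambda)f(y)-C|x-y|^2$ for all $x,y\in U$, $\lambda\in[0,1]$. $f:\mathbb{R}^N\to\mathbb{R}$ is locally semiconcave with linear modulus if every point has an open convex neighbourhood on which $f$ is semiconcave with some constant. *)

(* Defs.v *)
From mathcomp Require Export all_boot all_order all_algebra.
From mathcomp Require Export all_classical all_reals all_analysis.

Set Implicit Arguments.
Unset Strict Implicit.
Unset Printing Implicit Defensive.

Export Order.TTheory GRing.Theory Num.Theory numFieldNormedType.Exports.

Local Open Scope classical_set_scope.
Local Open Scope ring_scope.

(* The library norm on ['rV[R]_n] is the sup norm; [enorm] is the Euclidean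
   one.  They are equivalent, so topology, boundedness, Lipschitz and uniform
   continuity can be taken with respect to the library structures. *)
Definition enorm (R : realType) (n : nat) (x : 'rV[R]_n) : R :=
  Num.sqrt (\sum_(j < n) x 0 j ^+ 2).

Definition unif_continuous_on (U V : uniformType) (A : set U) (f : U -> V) :
  Prop := unif_continuous (f : subspace A -> V).

(* [f] is of class C^k on the open set [A].  This is meant for a finite
   dimensional [V], where continuity of all the directional derivatives of a
   differentiable function amounts to continuity of its differential. *)
Fixpoint class_C (R : realType) (V : normedModType R) (k : nat) (A : set V)
    (f : V -> R) : Prop :=
  if k is k'.+1 then
    (forall z, A z -> differentiable f z) /\
    (forall v : V, class_C k' A (fun z => 'D_v f z))
  else forall z, A z -> {for z, continuous f}.

Definition gradient (R : realType) (n : nat) (f : 'rV[R]_n -> R)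
    (x : 'rV[R]_n) : 'rV[R]_n :=
  \row_j 'D_('e_j) f x.

Definition hessian (R : realType) (n : nat) (f : 'rV[R]_n -> R)
    (x : 'rV[R]_n) : 'M[R]_n :=
  \matrix_(j, k) 'D_('e_j) (fun y => 'D_('e_k) f y) x.

Definition posdef (R : realType) (n : nat) (M : 'M[R]_n) : Prop :=
  forall v : 'rV[R]_n, v != 0 -> 0 < (v *m M *m v^T) 0 0.

Definition strictly_convex (R : realType) (V : lmodType R) (f : V -> R) :
  Prop := forall (p q : V) (a : R), p != q -> 0 < a < 1 ->
    f (a *: p + (1 - a) *: q) < a * f p + (1 - a) * f q.

(* Only the values of [a] on [0, +oo[ matter. *)
Definition superlinear (R : realType) (a : R -> R) : Prop :=
  a h / h @[h --> +oo] --> +oo.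

Record standing_hamiltonians (R : realType) (N m : nat)
    (H : 'I_m -> 'rV[R]_N -> 'rV[R]_N -> R) : Prop := StandingHamiltonians {
  ham_unif_continuous : forall (i : 'I_m) (r : R), 0 < r ->
    unif_continuous_on (setT `*` [set p | enorm p < r])
      (fun z : 'rV[R]_N * 'rV[R]_N => H i z.1 z.2);
  ham_superlinear : exists alpha beta : R -> R,
    [/\ superlinear alpha, superlinear beta &
      forall i x p, alpha (enorm p) <= H i x p <= beta (enorm p)];
  ham_strictly_convex : forall i x, strictly_convex (H i x);
  ham_C1 : forall i : 'I_m,
    class_C 1 setT (fun z : 'rV[R]_N * 'rV[R]_N => H i z.1 z.2)
}.

Record coupling_matrix (R : realType) (m : nat) (B : 'M[R]_m) : Prop :=
    CouplingMatrix {
  coupling_offdiag : forall i j, j != i -> B i j <= 0;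
  coupling_row_sum : forall i, \sum_j B i j = 0
}.

Definition loc_max (R : realType) (T : topologicalType) (f : T -> R) (z : T) :
  Prop := \forall w \near z, f w <= f z.

Definition loc_min (R : realType) (T : topologicalType) (f : T -> R) (z : T) :
  Prop := \forall w \near z, f z <= f w.

(* Left-hand side of the i-th equation at (t, x), with the derivatives of the
   test function [phi] in place of those of [u_i]. *)
Definition hj_lhs (R : realType) (N m : nat)
    (H : 'I_m -> 'rV[R]_N -> 'rV[R]_N -> R) (B : 'M[R]_m)
    (u : R * 'rV[R]_N -> 'cV[R]_m) (i : 'I_m) (phi : R * 'rV[R]_N -> R)
    (t : R) (x : 'rV[R]_N) : R :=
  derive1 (fun s => phi (s, x)) t
    + H i x (gradient (fun y => phi (t, y)) x)
    + (B *m u (t, x)) i 0.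

(* [u] is defined on all of R x R^N, but only its values at times t >= 0 are
   used. *)
Definition viscosity_solution (R : realType) (N m : nat)
    (H : 'I_m -> 'rV[R]_N -> 'rV[R]_N -> R) (B : 'M[R]_m)
    (u : R * 'rV[R]_N -> 'cV[R]_m) : Prop :=
  {within `[0, +oo[ `*` setT, continuous u} /\
  forall (t : R) (x : 'rV[R]_N) (i : 'I_m) (phi : R * 'rV[R]_N -> R),
    0 < t ->
    (exists2 O : set (R * 'rV[R]_N), open_nbhs (t, x) O & class_C 1 O phi) ->
    (loc_max (fun z => u z i 0 - phi z) (t, x) ->
      hj_lhs H B u i phi t x <= 0) /\
    (loc_min (fun z => u z i 0 - phi z) (t, x) ->
      0 <= hj_lhs H B u i phi t x).

Record is_cauchy_solution (R : realType) (N m : nat)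
    (H : 'I_m -> 'rV[R]_N -> 'rV[R]_N -> R) (B : 'M[R]_m)
    (u0 : 'rV[R]_N -> 'cV[R]_m) (u : R * 'rV[R]_N -> 'cV[R]_m) : Prop :=
    IsCauchySolution {
  cauchy_viscosity : viscosity_solution H B u;
  cauchy_initial : forall x, u (0, x) = u0 x;
  cauchy_bounded : forall T : R, 0 < T ->
    [bounded u z | z in `[0, T] `*` [set: 'rV[R]_N]];
  cauchy_unif_continuous : forall T : R, 0 < T ->
    unif_continuous_on (`[0, T] `*` [set: 'rV[R]_N]) u
}.

Definition semiconcave_on (R : realType) (N : nat) (U : set 'rV[R]_N) (C : R)
    (f : 'rV[R]_N -> R) : Prop :=
  forall (x y : 'rV[R]_N) (a : R), U x -> U y -> 0 <= a <= 1 ->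
    a * f x + (1 - a) * f y - C * enorm (x - y) ^+ 2
      <= f (a *: x + (1 - a) *: y).

Definition locally_semiconcave (R : realType) (N : nat)
    (f : 'rV[R]_N -> R) : Prop :=
  forall x : 'rV[R]_N, exists (U : set 'rV[R]_N) (C : R),
    [/\ open_nbhs x U, convex_set U, 0 < C & semiconcave_on U C f].

(* Main.v *)
(* The solution is Lipschitz continuous in time.  Barriers bound
   [|u (t, x) - u (0, x)|] by [A t], and doubling the variables with a smoothed
   penalty [A |t - s|] propagates this to later times: the penalty bounds the
   time slope of the touching paraboloids, so the coercivity of the Hamiltonians
   bounds their gradients, and no bound on the gradient of [u] is needed.

   For the semiconcavity near [(t0, x0)], fix [l] in ]0, 1[ and maximise
     l u_i(t, x) + (1 - l) u_i(s, z) - u_i(r, y)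
       - l (1 - l) K |x - z|^2 / rho(r, y)
       - (|l x + (1 - l) z - y|^2 + l (t - r)^2 + (1 - l) (s - r)^2) / e
   over the points and over the index [i], where
   [rho (r, y) = b^2 - (r - t0)^2 - |y - x0|^2] localises the problem.  Since [i]
   is maximal, the coupling terms have the right sign.  With
   [q = 2 K (x - z) / rho], the gradients at the three points are [p + (1 - l) q],
   [p - l q] and almost [p]; they are bounded by the time regularity and
   coercivity.  The uniform convexity in [p] on bounded sets gains a multiple of
   [l (1 - l) |q|^2], of size [K^2 |x - z|^2 / rho^2], and all the errors are of
   size at most [K |x - z|^2 / rho^2], up to a term of order [e].  For [K] large,
   a positive maximum is impossible as [e] tends to [0]. *)

Require Import Defs.
From mathcomp Require Import ring lra.

Set Implicit Arguments.
Unset Strict Implicit.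
Unset Printing Implicit Defensive.

Local Open Scope classical_set_scope.
Local Open Scope ring_scope.

(** * Euclidean norm and quadratic test functions *)

(** The constants of convexity and Lipschitz continuity of a C^2 Hamiltonian exist only on bounded
    sets of gradients, so the gradients at the touching points have to be bounded before convexity
    can be used. Where [u_i] is touched from above, a lower bound on the time slope and the equation
    bound the Hamiltonian from above, and coercivity bounds the gradient; this is why time
    regularity comes first. At (r, y) the function is touched from below and the equation gives no
    such bound, but the gradient there is close to the barycentre p of the two others. Nothing is
    known on second differences of the initial datum: the weight 1 / rho blows up on the boundary of
    a space-time ball, so neither the initial time nor the edge of the neighbourhood is felt. Three
    separate points are used because [u_i] need not be differentiable: freezing two of them yields a
    test function at the third. The penalties do not depend on the index, so maximality of i says
    that the i-th combination of values dominates the j-th; zero row sums and nonpositive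
    off-diagonal entries then make the i-th entry of B applied to these combinations nonnegative. *)

Lemma coord_le_norm (R : realType) (a b : nat) (M : 'M[R]_(a, b)) i j :
  `|M i j| <= `|M|.
Proof.
rewrite [leRHS]/Num.Def.normr /= mx_normrE.
by apply/bigmax_geP; right; exists (i, j).
Qed.

Section euclid.
Context {R : realType} {n : nat}.
Implicit Types x y p h : 'rV[R]_n.

Definition dot x y : R := \sum_(j < n) x 0 j * y 0 j.
Definition sq x : R := \sum_(j < n) x 0 j ^+ 2.

Lemma sqE x : sq x = dot x x.
Proof. by apply: eq_bigr => j _; rewrite expr2. Qed.

Lemma dotC x y : dot x y = dot y x.
Proof. by apply: eq_bigr => j _; rewrite mulrC. Qed.

Lemma dotDl x y p : dot (x + y) p = dot x p + dot y p.
Proof. by rewrite -big_split; apply: eq_bigr => j _; rewrite !mxE mulrDl. Qed.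

Lemma dotZl a x y : dot (a *: x) y = a * dot x y.
Proof. by rewrite mulr_sumr; apply: eq_bigr => j _; rewrite !mxE mulrA. Qed.

Lemma dotDr x y p : dot x (y + p) = dot x y + dot x p.
Proof. by rewrite dotC dotDl !(dotC x). Qed.

Lemma dotZr a x y : dot x (a *: y) = a * dot x y.
Proof. by rewrite dotC dotZl dotC. Qed.

Lemma dotNl x y : dot (- x) y = - dot x y.
Proof. by rewrite -scaleN1r dotZl mulN1r. Qed.

Lemma sqD x y : sq (x + y) = sq x + 2 * dot x y + sq y.
Proof. by rewrite !sqE dotDl !dotDr (dotC y x); ring. Qed.

Lemma sqZ a x : sq (a *: x) = a ^+ 2 * sq x.
Proof. by rewrite !sqE dotZl dotZr; ring. Qed.

Lemma sqN x : sq (- x) = sq x.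
Proof. by rewrite -scaleN1r sqZ sqrrN expr1n mul1r. Qed.

Lemma sqB x y : sq (x - y) = sq x - 2 * dot x y + sq y.
Proof. by rewrite sqD sqN dotC dotNl dotC; ring. Qed.

Lemma sq0 : sq 0 = 0.
Proof. by rewrite /sq big1// => j _; rewrite mxE expr0n. Qed.

Lemma sq_ge0 x : 0 <= sq x.
Proof. by apply: sumr_ge0 => j _; apply: sqr_ge0. Qed.

Lemma sq_coord x j : x 0 j ^+ 2 <= sq x.
Proof.
rewrite /sq (bigD1 j)//= lerDl; apply: sumr_ge0 => k _; exact: sqr_ge0.
Qed.

Lemma coord_le_sq x r j : 0 <= r -> sq x <= r ^+ 2 -> `|x 0 j| <= r.
Proof.
move=> r0 xr; have := le_trans (sq_coord x j) xr.
by rewrite -(real_normK (num_real (x 0 j))) ler_sqr ?nnegrE.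
Qed.

Lemma enorm_sq x : enorm x ^+ 2 = sq x.
Proof. by rewrite sqr_sqrtr// sq_ge0. Qed.

Lemma enorm_ge0 x : 0 <= enorm x.
Proof. exact: sqrtr_ge0. Qed.

Lemma norm_lt_coord x (d : R) : 0 < d -> (forall j, `|x 0 j| < d) -> `|x| < d.
Proof.
move=> d0 xd; rewrite [`|x|]/Num.Def.normr /= mx_normrE.
by apply/bigmax_ltP; split => // -[k j] _; rewrite ord1; exact: xd.
Qed.

End euclid.

Section continuity.
Context {R : realType} {n : nat} {T : topologicalType}.

Lemma continuous_dot (f g : T -> 'rV[R]_n) :
  continuous f -> continuous g -> continuous (fun z => dot (f z) (g z)).
Proof.
move=> cf cg z; apply: cvg_big => [w|j _]; first exact: (@add_continuous R^o).
apply: cvgM.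
  exact: (cvg_comp _ _ (cf z) (@coord_continuous _ _ _ 0 j (f z))).
exact: (cvg_comp _ _ (cg z) (@coord_continuous _ _ _ 0 j (g z))).
Qed.

Lemma continuous_sq (f : T -> 'rV[R]_n) :
  continuous f -> continuous (fun z => sq (f z)).
Proof.
by move=> cf; under eq_fun do rewrite sqE; exact: continuous_dot.
Qed.

End continuity.

(* The difference quotient of a function that is exactly quadratic along the
   line is [l + h * c]. *)
Lemma derive_quadratic (R : realType) (V : normedModType R) (f : V -> R)
    (z v : V) (l c : R) :
  (forall h : R, f (h *: v + z) = f z + h * l + h ^+ 2 * c) ->
  'D_v f z = l.
Proof.
move=> fq.
apply: cvg_lim => //.
have : (fun h : R => l + h * c) @ 0^' --> l + 0 * c.
  apply: (cvg_trans (cvg_app _ (cvg_within _))); apply: cvgD; first exact: cvg_cst.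
  by apply: cvgM; [exact: cvg_id|exact: cvg_cst].
rewrite mul0r addr0; apply: cvg_trans; apply: near_eq_cvg.
near=> h; have h0 : h != 0 by near: h; exact: nbhs_dnbhs_neq.
rewrite /= fq -[h^-1 *: _]/(h^-1 * _).
by field.
Unshelve. all: by end_near.
Qed.

Section quadratic_test_function.
Context {R : realType} {n : nat}.
Variables (t : R) (x : 'rV[R]_n) (a M : R) (p : 'rV[R]_n).
Implicit Types z v : R * 'rV[R]_n.

(** The quadratic part has zero first derivatives at [(t, x)], so only [a] and [p] enter the
    equation. One coefficient [M] serves time and space: touching bounds with different coefficients
    are relaxed to a common one. *)
Definition quad_test z : R :=
  a * (z.1 - t) + dot p (z.2 - x) + M * (sq (z.2 - x) + (z.1 - t) ^+ 2).

Lemma quad_testE (z v : R * 'rV[R]_n) (h : R) : quad_test (h *: v + z) =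
  quad_test z + h * (a * v.1 + dot p v.2
     + 2 * M * (dot (z.2 - x) v.2 + (z.1 - t) * v.1))
  + h ^+ 2 * (M * (sq v.2 + v.1 ^+ 2)).
Proof.
rewrite /quad_test /= -[h *: v.1]/(h * v.1) -!addrA.
rewrite [h *: v.2 + _]addrC !sqD !dotDr !sqZ !dotZr.
by ring.
Qed.

Lemma class_C1_quad_test : class_C 1 setT quad_test.
Proof.
split=> [z _|v].
  have d1 : differentiable (fun z : R * 'rV[R]_n => z.1 - t) z.
    apply: differentiableB => //; apply: (@linear_differentiable _ _ _ fst).
    by move=> w; exact: cvg_fst.
  have dx : differentiable (fun z : R * 'rV[R]_n => z.2 - x) z.
    apply: differentiableB => //; apply: (@linear_differentiable _ _ _ snd).
    by move=> w; exact: cvg_snd.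
  have d2 j : differentiable (fun z : R * 'rV[R]_n => (z.2 - x) 0 j) z.
    apply: (@differentiable_comp _ _ _ _ (fun z : R * 'rV[R]_n => z.2 - x)
      (fun y : 'rV[R]_n => y 0 j)) => //.
    exact: differentiable_coord.
  rewrite /quad_test.
  apply: differentiableD; first apply: differentiableD.
  - by apply: differentiableM => //; exact: differentiable_cst.
  - rewrite [X in differentiable X _](_ : _ =
      \sum_(j < n) (fun z : R * 'rV[R]_n => p 0 j * (z.2 - x) 0 j)).
      apply: differentiable_sum => j; apply: differentiableM; last exact: d2.
      exact: differentiable_cst.
    by rewrite fct_sumE.
  - apply: differentiableM; first exact: differentiable_cst.
    apply: differentiableD; last first.
      by rewrite [X in differentiable X _](_ : _ =
        (fun z : R * 'rV[R]_n => z.1 - t) ^+ 2); [exact: differentiableX|].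
    rewrite [X in differentiable X _](_ : _ =
      \sum_(j < n) (fun z : R * 'rV[R]_n => (z.2 - x) 0 j) ^+ 2).
      by apply: differentiable_sum => j; apply: differentiableX; exact: d2.
    by rewrite fct_sumE.
move=> z _; rewrite [X in {for z, continuous X}](_ : _ = fun z => a * v.1
    + dot p v.2 + 2 * M * (dot (z.2 - x) v.2 + (z.1 - t) * v.1)); last first.
  by apply/funext => w; exact: (derive_quadratic (quad_testE w v)).
have cv1 : (fun z : R * 'rV[R]_n => z.1) @ z --> z.1 by exact: cvg_fst.
have c2 : continuous (fun z : R * 'rV[R]_n => z.2 - x).
  by move=> w; apply: cvgB; [exact: cvg_snd|exact: cvg_cst].
apply: cvgD; first exact: cvg_cst.
apply: cvgM; first exact: cvg_cst.
apply: cvgD.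
  apply: (@continuous_dot _ _ _ (fun z : R * 'rV[R]_n => z.2 - x) (fun=> v.2)) => //.
  by move=> w; exact: cvg_cst.
by apply: cvgM; [apply: cvgB => //; exact: cvg_cst|exact: cvg_cst].
Qed.

Lemma derive1_quad_test : derive1 (fun s => quad_test (s, x)) t = a.
Proof.
rewrite derive1E; apply: (@derive_quadratic _ R^o _ _ _ _ M) => h.
rewrite /quad_test /= subrr sq0 /dot !big1; first by rewrite -[h *: 1]/(h * 1); ring.
all: by move=> j _; rewrite !mxE mulr0.
Qed.

Lemma gradient_quad_test : gradient (fun y => quad_test (t, y)) x = p.
Proof.
apply/rowP => j; rewrite mxE.
apply: (@derive_quadratic _ _ _ _ _ _ (M * sq ('e_j : 'rV[R]_n))) => h.
rewrite /quad_test /= !subrr addrK sqZ sq0 /dot.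
rewrite (bigD1 j)//= !mxE !eqxx big1 => [|k kj]; last first.
  by rewrite !mxE (negbTE kj) mulr0 mulr0.
by rewrite [\sum_(j < n) _]big1 => [|k _]; [rewrite andbT/=; ring|rewrite !mxE mulr0].
Qed.

End quadratic_test_function.

Section jets.
Context {R : realType} {N m : nat}.
Variables (H : 'I_m -> 'rV[R]_N -> 'rV[R]_N -> R) (B : 'M[R]_m)
  (u : R * 'rV[R]_N -> 'cV[R]_m).
Hypothesis hu : viscosity_solution H B u.

(** Paraboloids are the only test functions used below. Every [M] is allowed, so a one-sided
    quadratic bound near the point is enough to read off the equation. *)
Lemma sub_jet (i : 'I_m) (t : R) (x : 'rV[R]_N) (a : R) (p : 'rV[R]_N) (M : R) :
  0 < t ->
  (\forall z \near (t, x), u z i 0 <= u (t, x) i 0 + quad_test t x a M p z) ->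
  a + H i x p + \sum_j B i j * u (t, x) j 0 <= 0.
Proof.
move=> t0 le_u.
have [] := hu.2 t x i (quad_test t x a M p) t0.
  by exists setT; [split; [exact: openT|]|exact: class_C1_quad_test].
have q0 : quad_test t x a M p (t, x) = 0.
  by rewrite /quad_test /= !subrr sq0 /dot big1 => [|j _]; [ring|rewrite mxE mulr0].
move=> + _; rewrite /hj_lhs derive1_quad_test gradient_quad_test mxE; apply.
by apply: filterS le_u => z; rewrite q0 subr0 lerBlDr.
Qed.

Lemma super_jet (i : 'I_m) (t : R) (x : 'rV[R]_N) (a : R) (p : 'rV[R]_N) (M : R) :
  0 < t ->
  (\forall z \near (t, x), u (t, x) i 0 + quad_test t x a M p z <= u z i 0) ->
  0 <= a + H i x p + \sum_j B i j * u (t, x) j 0.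
Proof.
move=> t0 le_u.
have [] := hu.2 t x i (quad_test t x a M p) t0.
  by exists setT; [split; [exact: openT|]|exact: class_C1_quad_test].
have q0 : quad_test t x a M p (t, x) = 0.
  by rewrite /quad_test /= !subrr sq0 /dot big1 => [|j _]; [ring|rewrite mxE mulr0].
move=> _; rewrite /hj_lhs derive1_quad_test gradient_quad_test mxE; apply.
by apply: filterS le_u => z; rewrite q0 subr0 lerBrDr.
Qed.

End jets.

(** * Bounds on the Hamiltonians *)

Lemma unif_continuous_onP (R : realType) (U V : pseudoMetricType R) (A : set U)
    (f : U -> V) : unif_continuous_on A f ->
  forall e, 0 < e -> exists2 d, 0 < d &
    forall x y, A x -> A y -> ball x d y -> ball (f x) e (f y).
Proof.
move=> uf e e0.
have : entourage [set xy : V * V | ball xy.1 e xy.2].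
  by rewrite -entourage_ballE; exists e.
move/uf; rewrite /nbhs/= -entourage_ballE => -[d /= d0 dW].
exists d => // x y Ax Ay xy; apply: (dW (x, y)).
by rewrite /ball /= /subspace_ball mem_set.
Qed.

Section hamiltonian.
Context {R : realType} {N m : nat} {H : 'I_m -> 'rV[R]_N -> 'rV[R]_N -> R}.
Hypothesis hH : standing_hamiltonians H.

Lemma ham_grows : exists2 r : R, 0 < r &
  forall i x p, r <= enorm p -> enorm p <= H i x p.
Proof.
have [al [be [sal _ hab]]] := ham_superlinear hH.
have /cvgryPge /(_ 1) [M [_ hM]] := sal.
exists (`|M| + 1) => [|i x p hp]; first by rewrite ltr_wpDl.
have p0 : 0 < enorm p by apply: lt_le_trans hp; rewrite ltr_wpDl.
have /andP[+ _] := hab i x p; apply: le_trans.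
have := hM (enorm p); rewrite ler_pdivlMr// mul1r; apply.
by apply: lt_le_trans hp; apply: (le_lt_trans (ler_norm M)); rewrite ltrDl.
Qed.

Lemma ham_coercive (C : R) : exists2 r : R, 0 < r &
  forall i x p, H i x p <= C -> sq p <= r ^+ 2.
Proof.
have [r0 r00 hr] := ham_grows; exists (r0 + `|C|).
  by rewrite ltr_pwDl.
move=> i x p hC; have C0 := normr_ge0 C.
rewrite -enorm_sq ler_sqr ?nnegrE ?enorm_ge0//; last lra.
have [/(hr i x) h|h] := leP r0 (enorm p).
  have := ler_norm C; lra.
by lra.
Qed.

Lemma enormZ a (p : 'rV[R]_N) : enorm (a *: p) = `|a| * enorm p.
Proof.
by rewrite /enorm -/(sq _) sqZ sqrtrM ?sqr_ge0// sqrtr_sqr.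
Qed.

Lemma enorm_gt0 (p : 'rV[R]_N) : p != 0 -> 0 < enorm p.
Proof.
move=> p0; rewrite lt_neqAle enorm_ge0 andbT; apply: contra_neq p0 => e0.
apply/rowP => j; rewrite mxE; apply/eqP; rewrite -normr_le0.
by apply: coord_le_sq => //; rewrite -enorm_sq -e0.
Qed.

(** [alpha] is an arbitrary function and may be unbounded below on bounded sets, so it is used only
    at 0 and, through [ham_grows], for large [p]. For small [p], convexity between [p] and an
    opposite point of norm [r] bounds [H i x p] below by the values at 0 and at that point. *)
Lemma ham_ge : exists2 C : R, 0 <= C & forall i x p, - C <= H i x p.
Proof.
have [al [be [_ _ hab]]] := ham_superlinear hH.
have [r r0 hr] := ham_grows.
exists (2 * (`|al 0| + `|be r|)) => [|i x p]; first by rewrite mulr_ge0 ?addr_ge0.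
have [/(hr i x) h|h] := leP r (enorm p).
  apply: le_trans h; apply: le_trans (enorm_ge0 p).
  by rewrite oppr_le0 mulr_ge0 ?addr_ge0.
have /andP[a0 _] := hab i x 0.
have e0 : enorm (0 : 'rV[R]_N) = 0 by rewrite /enorm -/(sq _) sq0 sqrtr0.
rewrite e0 in a0.
have [->|p0] := eqVneq p 0.
  apply: le_trans a0; have := ler_norm (- al 0); rewrite normrN.
  have := normr_ge0 (al 0); have := normr_ge0 (be r); lra.
have ep0 := enorm_gt0 p0.
set k := r / enorm p; have k0 : 0 < k by rewrite divr_gt0.
(* The weight for which [a *: p + (1 - a) *: (- k *: p)] vanishes. It is at least 1/2, so dividing
   by it costs the factor 2 in the constant. *)
pose a : R := k / (1 + k).
have k1 : 1 + k != 0 by rewrite gt_eqF// ltr_wpDl.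
have a01 : 0 < a < 1.
  by rewrite divr_gt0 ?ltr_wpDl//= ltr_pdivrMr ?ltr_wpDl// mul1r ltrDr.
have a12 : 1 / 2 <= a.
  rewrite ler_pdivlMr ?ltr_wpDl// /k.
  have : 1 <= r / enorm p by rewrite ler_pdivlMr// mul1r ltW.
  lra.
have pq : p != - k *: p.
  rewrite -subr_eq0 scaleNr opprK -[p in p + _]scale1r -scalerDl.
  by rewrite scaler_eq0 negb_or k1.
have := ham_strictly_convex hH i x pq a01.
rewrite (_ : a *: p + _ = 0); last first.
  rewrite scalerA -scalerDl (_ : _ + _ = 0) ?scale0r// /a.
  by field.
have /andP[_ b0] := hab i x (- k *: p).
rewrite enormZ normrN gtr0_norm// divfK ?gt_eqF// in b0.
move=> hcv.
have := ler_norm (- al 0); rewrite normrN => n1.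
have := ler_norm (be r) => n2; have := normr_ge0 (be r); have := normr_ge0 (al 0).
case/andP: a01 => a_0 a_1 ? ?; nra.
Qed.

(** [beta] need not be bounded on bounded sets either. A nonzero [p] lies between two opposite
    points of norm [s], so by convexity only the values of [beta] at 0 and at [s] matter. *)
Lemma ham_le (r : R) : exists2 C : R, 0 <= C &
  forall i x p, sq p <= r ^+ 2 -> H i x p <= C.
Proof.
have [al [be [_ _ hab]]] := ham_superlinear hH.
pose s : R := `|r| + 1; have s0 : 0 < s by rewrite ltr_wpDl.
exists (`|be 0| + `|be s|) => [|i x p]; first exact: addr_ge0.
rewrite -enorm_sq -(real_normK (num_real r)) ler_sqr ?nnegrE ?enorm_ge0// => hp.
have [->|p0] := eqVneq p 0.
  have /andP[_ ] := hab i x 0.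
  have -> : enorm (0 : 'rV[R]_N) = 0 by rewrite /enorm -/(sq _) sq0 sqrtr0.
  by move/le_trans; apply; rewrite (le_trans (ler_norm _))// lerDl.
have ep0 := enorm_gt0 p0.
pose k : R := s / enorm p; have k0 : 0 < k by rewrite divr_gt0.
have ps : enorm p < s by rewrite (le_lt_trans hp)// ltrDl.
have k1 : 1 < k by rewrite ltr_pdivlMr// mul1r.
pose a : R := (1 + k) / (2 * k).
have a01 : 0 < a < 1.
  by apply/andP; split; [apply: divr_gt0|rewrite /a ltr_pdivrMr]; lra.
have pq : k *: p != - k *: p.
  rewrite -subr_eq0 scaleNr opprK -scalerDl scaler_eq0 negb_or p0 andbT.
  by rewrite gt_eqF// addr_gt0.
have := ham_strictly_convex hH i x pq a01.
rewrite (_ : a *: _ + _ = p); last first.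
  rewrite !scalerA -scalerDl -[RHS]scale1r; congr (_ *: _); rewrite /a.
  by field; rewrite gt_eqF.
have /andP[_] := hab i x (- k *: p).
have /andP[_] := hab i x (k *: p).
rewrite !enormZ normrN gtr0_norm// divfK ?gt_eqF// => b1 b2 hcv.
have := ler_norm (be s) => n2; have := normr_ge0 (be 0).
case/andP: a01 => a_0 a_1 ?; nra.
Qed.

Lemma ham_unif i (r e : R) : 0 < r -> 0 < e -> exists2 d : R, 0 < d &
  forall (x y p q : 'rV[R]_N), sq p < r ^+ 2 -> sq q < r ^+ 2 ->
    (forall j, `|x 0 j - y 0 j| < d) -> (forall j, `|p 0 j - q 0 j| < d) ->
    `|H i x p - H i y q| < e.
Proof.
move=> r0 e0.
have /unif_continuous_onP /(_ e e0) [d d0 hd] := ham_unif_continuous hH i r0.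
have er (p : 'rV[R]_N) : sq p < r ^+ 2 -> enorm p < r.
  by rewrite -enorm_sq ltr_sqr ?nnegrE ?enorm_ge0// ltW.
exists d => // x y p q /er pr /er qr xy pq; apply: (hd (x, p) (y, q)) => //.
by split; rewrite -ball_normE; apply: norm_lt_coord => // j; rewrite !mxE.
Qed.

End hamiltonian.

(** * Local uniform convexity of a C^2 function *)

Lemma is_derive_continuous (R : realType) (f df : R -> R) :
  (forall s : R, is_derive s 1 f (df s)) -> continuous f.
Proof.
move=> h s; apply: differentiable_continuous.
by apply/derivable1_diffP; have [] := h s.
Qed.

Lemma mean_value (R : realType) (f df : R -> R) (a b : R) : a <= b ->
  (forall s : R, is_derive s 1 f (df s)) ->
  exists c : R, [/\ a <= c, c <= b & f b - f a = df c * (b - a)].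
Proof.
move=> ab h; have [c|c] := @MVT_segment _ f df a b ab (fun x _ => h x).
  exact/continuous_subspaceT/(is_derive_continuous h).
by rewrite in_itv => /andP[ac cb] e; exists c.
Qed.

(** Subtracting [mu / 2 * s ^ 2] leaves a function with nondecreasing slope; its mean slopes on the
    two sides of 0 are compared. The ends [1 - l] and [- l] have barycentre 0 for the weights [l]
    and [1 - l], and the weighted mean of their squares is [l * (1 - l)]. *)
Lemma strong_convexity (R : realType) (g g1 g2 : R -> R) (mu l : R) :
  (forall s : R, is_derive s 1 g (g1 s)) -> (forall s : R, is_derive s 1 g1 (g2 s)) ->
  0 <= l <= 1 -> (forall s, - l <= s <= 1 - l -> mu <= g2 s) ->
  l * (1 - l) * (mu / 2) <= l * g (1 - l) + (1 - l) * g (- l) - g 0.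
Proof.
move=> dg dg1 /andP[l0 l1] hmu.
pose h s := g s - mu / 2 * (s * s).
pose h1 s := g1 s - mu * s.
have dh (s : R) : is_derive s 1 h (h1 s).
  have := dg s => ?; apply: is_derive_eq; rewrite /h1 /GRing.scale /=; lra.
have dh1 (s : R) : is_derive s 1 h1 (g2 s - mu).
  have := dg1 s => ?; apply: is_derive_eq; rewrite /GRing.scale /=; lra.
have l1' : 0 <= 1 - l by lra.
have [a [a0 al ha]] := mean_value l1' dh.
have l0' : - l <= 0 by lra.
have [b [bl b0 hb]] := mean_value l0' dh.
have [c [bc ca hc]] := mean_value (le_trans b0 a0) dh1.
have mc : mu <= g2 c by apply: hmu; apply/andP; split; lra.
have : 0 <= h1 a - h1 b.
  rewrite hc; apply: mulr_ge0; lra.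
move=> hab; have : 0 <= l * (1 - l) * (h1 a - h1 b).
  by apply: mulr_ge0 => //; apply: mulr_ge0.
have e1 : l * (h (1 - l) - h 0) = l * (1 - l) * h1 a by rewrite ha; ring.
have e2 : (1 - l) * (h 0 - h (- l)) = l * (1 - l) * h1 b by rewrite hb; ring.
rewrite mulrBr -e1 -e2 /h; nra.
Qed.

Section phase_space.
Context {R : realType} {N : nat}.
Local Notation V := ('rV[R]_N * 'rV[R]_N)%type.
Local Notation I := (bool * 'I_N)%type.

(** The flag is [true] on the momentum variable and [false] on the position variable. *)
Definition ps_basis (k : I) : V := if k.1 then (0, 'e_k.2) else ('e_k.2, 0).
Definition ps_coord (v : V) (k : I) : R := if k.1 then v.2 0 k.2 else v.1 0 k.2.

Lemma sum_boolpair (M : nmodType) (f : I -> M) :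
  \sum_k f k = \sum_j f (true, j) + \sum_j f (false, j).
Proof.
rewrite (eq_bigr (fun k => f (k.1, k.2))) => [|[]//].
by rewrite -(pair_bigA _ (fun b j => f (b, j)))/= big_bool.
Qed.

Lemma ps_decomp (v : V) : v = \sum_k ps_coord v k *: ps_basis k.
Proof.
rewrite sum_boolpair /ps_coord /ps_basis /=.
have f1 (s : seq 'I_N) (f g : 'I_N -> 'rV[R]_N) :
    \sum_(j <- s) (f j, g j) = (\sum_(j <- s) f j, \sum_(j <- s) g j) :> V.
  by elim/big_rec3: _ => // j a b c _ ->.
rewrite (eq_bigr (fun j => (0, v.2 0 j *: 'e_j))) => [|j _]; last first.
  by congr (_, _); rewrite scaler0.
rewrite [X in _ = _ + X](eq_bigr (fun j => (v.1 0 j *: 'e_j, 0))) => [|j _]; last first.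
  by congr (_, _); rewrite scaler0.
rewrite !f1 !big1_eq -!row_sum_delta [LHS]surjective_pairing.
by congr (_, _); rewrite ?add0r ?addr0.
Qed.

Lemma derive_ps (f : V -> R) z v : differentiable f z ->
  'D_v f z = \sum_k ps_coord v k * 'D_(ps_basis k) f z.
Proof.
move=> df; rewrite deriveE// [in LHS](ps_decomp v) linear_sum.
by apply: eq_bigr => k _; rewrite linearZ deriveE.
Qed.

Lemma is_derive_line (f : V -> R) z v (s : R) : (forall w, differentiable f w) ->
  is_derive s 1 (fun s => f (z + s *: v))
    (\sum_k ps_coord v k * 'D_(ps_basis k) f (z + s *: v)).
Proof.
move=> df; rewrite -(derive_ps v (df _)).
have eqq : (fun h : R => h^-1 *: (((fun s => f (z + s *: v)) \o shift s) (h *: (1 : R))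
      - f (z + s *: v))) =
    (fun h : R => h^-1 *: ((f \o shift (z + s *: v)) (h *: v) - f (z + s *: v))).
  apply/funext => h /=; congr (_ *: (f _ - _)).
  by rewrite [h *: 1]mulr1 scalerDl addrCA.
have dd : derivable f (z + s *: v) v by exact: diff_derivable.
by split; rewrite /derivable /derive eqq.
Qed.

End phase_space.

Section compact_box.
Context {R : realType} {N : nat}.

(** Closed sup-norm balls: compact as products of segments, and suited to coordinatewise
    estimates. *)
Definition box (x : 'rV[R]_N) (r : R) : set 'rV[R]_N :=
  [set y | forall j, `|y 0 j - x 0 j| <= r].

Lemma compact_box x r : compact (box x r).
Proof.
have := @rV_compact R N (fun j => `[x 0 j - r, x 0 j + r]%classic).
move=> /(_ (fun j => @segment_compact _ _ _)); congr compact.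
by apply/seteqP; split => y /= h j; have := h j; rewrite in_itv/= ler_distl.
Qed.

Lemma box_center x r : 0 <= r -> box x r x.
Proof. by move=> r0 j; rewrite subrr normr0. Qed.

Lemma box_convex x r y z (l : R) : box x r y -> box x r z -> 0 <= l <= 1 ->
  box x r (l *: y + (1 - l) *: z).
Proof.
move=> hy hz /andP[l0 l1] j; rewrite !mxE.
have := hy j; have := hz j; rewrite !ler_distl => /andP[? ?] /andP[? ?].
by apply/andP; split; nra.
Qed.

End compact_box.

Section local_bounds.
Context {R : realType} {N : nat} {F : 'rV[R]_N * 'rV[R]_N -> R}.
Local Notation V := ('rV[R]_N * 'rV[R]_N)%type.
Local Notation I := (bool * 'I_N)%type.
Hypothesis hF : class_C 2 setT F.

Let D1 k z := 'D_(ps_basis k) F z.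
Let D2 l k z := 'D_(ps_basis l) (D1 k) z.

Let dF z : differentiable F z. Proof. by have [+ _] := hF; exact. Qed.

Let dD1 k z : differentiable (D1 k) z.
Proof. by have [_ /(_ (ps_basis k))[+ _]] := hF; exact. Qed.

Let cD2 l k : continuous (D2 l k).
Proof.
by have [_ /(_ (ps_basis k))[_ /(_ (ps_basis l)) h]] := hF => z; exact: h.
Qed.

Let cD1 k : continuous (D1 k).
Proof. by move=> z; exact: differentiable_continuous. Qed.

Lemma compact_family_bound (T : topologicalType) (J : finType) (K : set T)
    (f : J -> T -> R) : compact K -> (forall j, continuous (f j)) ->
  exists2 C : R, 0 < C & forall j z, K z -> `|f j z| <= C.
Proof.
move=> cK cf.
have hb j : exists C : R, forall z, K z -> `|f j z| <= C.
  have : bounded_set (f j @` K).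
    by apply: compact_bounded; apply: continuous_compact => //;
       exact: continuous_subspaceT.
  move=> [M [_ hM]]; exists (M + 1) => z Kz.
  by apply: hM; [rewrite ltrDl|exists z].
pose C j := projT1 (cid (hb j)).
exists (1 + \sum_j `|C j|).
  by apply: ltr_pwDl => //; apply: sumr_ge0.
move=> j z Kz; apply: (le_trans (projT2 (cid (hb j)) z Kz)).
apply: (le_trans (ler_norm _)); rewrite (bigD1 j)//= addrCA lerDl.
by apply: addr_ge0 => //; apply: sumr_ge0.
Qed.

Lemma local_lipschitz (x0 p0 : 'rV[R]_N) (r s : R) : exists2 L : R, 0 < L &
  forall x y p q, box x0 r x -> box x0 r y -> box p0 s p -> box p0 s q ->
    `|F (x, p) - F (y, q)| <=
    L * \sum_j (`|x 0 j - y 0 j| + `|p 0 j - q 0 j|).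
Proof.
have [] := @compact_family_bound _ _ (box x0 r `*` box p0 s) D1 _ cD1.
  by apply: compact_setX; exact: compact_box.
move=> L L0 hL; exists L => // x y p q hx hy hp hq.
pose v : V := (x - y, p - q).
have h (t : R) : is_derive t 1 (fun t => F ((y, q) + t *: v)) _ :=
  is_derive_line (y, q) v t dF.
have [c [c0 c1 hc]] := mean_value ler01 h.
have e1 : (y, q) + 1 *: v = (x, p).
  by rewrite scale1r; congr (_, _); rewrite /= addrC subrK.
rewrite e1 scale0r addr0 subr0 mulr1 in hc; rewrite hc.
apply: (le_trans (ler_norm_sum _ _ _)).
rewrite sum_boolpair big_split addrC mulrDr !mulr_sumr /=.
have hK : (box x0 r `*` box p0 s) ((y, q) + c *: v).
  have c01 : 0 <= c <= 1 by rewrite c0.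
  have eq1 (a b : 'rV[R]_N) : b + c *: (a - b) = c *: a + (1 - c) *: b.
    by rewrite scalerBr scalerBl scale1r addrCA.
  by split; rewrite /= eq1; exact: box_convex.
by apply: lerD; apply: ler_sum => j _; rewrite normrM mulrC /ps_coord /= !mxE;
  apply: ler_wpM2r => //; exact: hL.
Qed.

Let quad (z : V) (v : V) : R :=
  \sum_k ps_coord v k * (\sum_l ps_coord v l * D2 l k z).

Lemma second_order_line (c d p q : 'rV[R]_N) (l mu : R) : 0 <= l <= 1 ->
  (forall s : R, - l <= s <= 1 - l ->
     mu <= quad (c + s *: d, p + s *: q) (d, q)) ->
  l * (1 - l) * (mu / 2) <=
    l * F (c + (1 - l) *: d, p + (1 - l) *: q)
    + (1 - l) * F (c - l *: d, p - l *: q) - F (c, p).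
Proof.
move=> l01 hmu.
have h (t : R) : is_derive t 1 (fun t => F ((c, p) + t *: ((d, q) : V))) _ :=
  is_derive_line (c, p) (d, q) t dF.
have h1 (t : R) : is_derive t 1 (fun t => \sum_k ps_coord (d, q) k *
    D1 k ((c, p) + t *: ((d, q) : V))) (quad ((c, p) + t *: ((d, q) : V)) (d, q)).
  rewrite /quad (_ : (fun t => _) = \sum_k (fun t => ps_coord (d, q) k *
    D1 k ((c, p) + t *: ((d, q) : V)))); last by rewrite fct_sumE.
  have hk k : is_derive t 1 (fun t => D1 k ((c, p) + t *: ((d, q) : V)))
      (\sum_l ps_coord (d, q) l * D2 l k ((c, p) + t *: ((d, q) : V))).
    exact: is_derive_line (c, p) (d, q) t (dD1 k).
  elim/big_rec2 : _ => [|k y f _ hf]; first exact: is_derive_cst.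
  apply: is_deriveD.
have := strong_convexity h h1 l01 hmu.
by rewrite scale0r addr0 scaleNr.
Qed.

Hypothesis N0 : (0 < N)%N.
Hypothesis pos : forall x p, posdef (hessian (fun p => F (x, p)) p).

(** Deriving the slice [fun p => F (x, p)] along [v] is deriving [F] along [(0, v)], so positive
    definiteness in [p] concerns the momentum block of [D2]. *)
Let D2_hess x p j k : hessian (fun p => F (x, p)) p j k =
  D2 (true, j) (true, k) (x, p).
Proof.
have dE (f : V -> R) (y w v : 'rV[R]_N) :
    'D_v (fun p => f (y, p)) w = 'D_((0, v) : V) f (y, w).
  have eqq : (fun h : R => h^-1 *: (((fun p => f (y, p)) \o shift w) (h *: v) - f (y, w)))
      = (fun h : R => h^-1 *: ((f \o shift (y, w)) (h *: ((0, v) : V)) - f (y, w))).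
    apply/funext => h /=; congr (_ *: (f _ - _)).
    by congr (_, _); rewrite /= scaler0 add0r.
  by rewrite /derive eqq.
rewrite mxE; under eq_fun do rewrite dE.
by rewrite (dE (D1 (true, k))).
Qed.

Let quad2 (z : V) (q : 'rV[R]_N) : R :=
  \sum_k q 0 k * (\sum_l q 0 l * D2 (true, l) (true, k) z).

Let quad2_gt0 z q : q != 0 -> 0 < quad2 z q.
Proof.
move=> q0; have := pos z.1 z.2 q0.
rewrite mxE; congr (_ < _); apply: eq_bigr => k _.
rewrite !mxE mulrC; congr (_ * _); apply: eq_bigr => j _.
by rewrite D2_hess -surjective_pairing.
Qed.

Let quad2_continuous : continuous (fun w : V * 'rV[R]_N => quad2 w.1 w.2).
Proof.
have cc k : continuous (fun w : V * 'rV[R]_N => w.2 0 k).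
  move=> w; apply: (@continuous_comp _ _ _ snd (fun y : 'rV[R]_N => y 0 k)).
    exact: cvg_snd.
  exact: coord_continuous.
move=> w; apply: cvg_big => [z|k _]; first exact: (@add_continuous R^o).
apply: cvgM; first exact: cc.
apply: cvg_big => [z|l _]; first exact: (@add_continuous R^o).
apply: cvgM; first exact: cc.
apply: (@continuous_comp _ _ _ fst (D2 (true, l) (true, k))).
  exact: cvg_fst.
exact: cD2.
Qed.

(** [quad2] is 2-homogeneous in [q], so [th] is its minimum over the box times the unit sphere. This
    minimum is attained by compactness, hence positive; [N0] supplies a unit vector, so the set is
    nonempty. *)
Lemma quad2_lower x0 p0 r s : 0 <= r -> 0 <= s -> exists2 th : R, 0 < th &
  forall z q, (box x0 r `*` box p0 s) z -> th * sq q <= quad2 z q.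
Proof.
move=> r0 s0.
pose S := box 0 1 `&` [set q : 'rV[R]_N | sq q = 1].
have cS : compact S.
  apply: compact_closedI; first exact: compact_box.
  rewrite (_ : [set _ | _] = sq @^-1` [set (1 : R)])//.
  apply: closed_comp => [q _|]; last exact: closed_eq.
  by apply: (@continuous_sq _ _ _ id) => ?; exact: cvg_id.
pose K := (box x0 r `*` box p0 s) `*` S.
have cK : compact K by do 2?[apply: compact_setX => //]; exact: compact_box.
have K0 : K !=set0.
  exists ((x0, p0), 'e_(Ordinal N0)); split => /=.
    by split; exact: box_center.
  split => /= [j|].
    by rewrite !mxE subr0 eqxx /=; case: (j == _); rewrite ?normr0 ?normr1.
  rewrite /sq (bigD1 (Ordinal N0))//= big1 => [|j j0].
    by rewrite !mxE !eqxx expr1n addr0.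
  by rewrite !mxE (negbTE j0) andbF expr0n.
have [w wK hmin] := compact_EVT_min K0 cK (continuous_subspaceT quad2_continuous).
exists (quad2 w.1 w.2).
  apply: quad2_gt0; move: wK; rewrite inE => -[_ [_ /= w1]].
  apply/eqP => w0; move: w1; rewrite w0 sq0; lra.
move=> z q zK; have [->|q0] := eqVneq q 0.
  rewrite sq0 mulr0 /quad2 big1// => k _; by rewrite mxE mul0r.
have e0 := enorm_gt0 q0.
have hq : sq ((enorm q)^-1 *: q) = 1.
  by rewrite sqZ -enorm_sq -exprMn mulVf ?gt_eqF// expr1n.
have := hmin (z, (enorm q)^-1 *: q); rewrite inE => /(_ _)/=.
have -> : quad2 z ((enorm q)^-1 *: q) = (enorm q) ^- 2 * quad2 z q.
  rewrite /quad2 mulr_sumr; apply: eq_bigr => k _.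
  rewrite !mxE -exprVn expr2 -!mulrA; congr (_ * _).
  rewrite mulrCA; congr (_ * _); rewrite mulr_sumr.
  by apply: eq_bigr => l _; rewrite mxE mulrA.
rewrite ler_pdivlMl ?exprn_gt0// mulrC enorm_sq; apply.
split => //; split => //= j; rewrite [X in _ - X]mxE subr0.
by apply: coord_le_sq => //; rewrite hq expr1n.
Qed.

Lemma quad_lower x0 p0 r s : 0 <= r -> 0 <= s -> exists2 th : R, 0 < th &
  exists2 C : R, 0 < C & forall z v, (box x0 r `*` box p0 s) z ->
    th * sq v.2 - C * sq v.1 <= quad z v.
Proof.
move=> r0 s0; have [th th0 hth] := quad2_lower x0 p0 r0 s0.
have [] := @compact_family_bound _ (I * I)%type (box x0 r `*` box p0 s)
  (fun a => D2 a.1 a.2) _ (fun a => @cD2 a.1 a.2).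
  by apply: compact_setX; exact: compact_box.
move=> C C0 hC.
have n0 : 0 < N%:R :> R by rewrite ltr0n.
(* Young's parameter: each of the two mixed blocks costs [th / 4 * sq v.2], so half of the momentum
   gain survives. *)
pose et : R := th / (4 * C * N%:R).
have et0 : 0 < et by rewrite divr_gt0// !mulr_gt0.
exists (th / 2); first by lra.
(* The first term pays for the position block, the second for the position parts of the two mixed
   blocks. *)
exists (C * N%:R + C * N%:R / (2 * et)).
  by have CN := mulr_gt0 C0 n0; rewrite addr_gt0// divr_gt0// mulr_gt0.
move=> z v zK.
have bnd (a b e : R) k l : 0 < e ->
    - (C * (e * a ^+ 2 + (4 * e)^-1 * b ^+ 2)) <= a * (b * D2 k l z).
  move=> e0; have := hC (k, l) z zK => /= h.
  have ab : `|a * b| <= e * a ^+ 2 + (4 * e)^-1 * b ^+ 2.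
    have e00 : e != 0 by rewrite gt_eqF.
    pose t : R := (2 * e)^-1.
    have -> : (4 * e)^-1 = e * t ^+ 2 by rewrite /t; field.
    have -> : a * b = 2 * e * (a * (t * b)) by rewrite /t; field.
    rewrite ler_norml; apply/andP; split.
      have := mulr_ge0 (ltW e0) (sqr_ge0 (a + t * b)); lra.
    have := mulr_ge0 (ltW e0) (sqr_ge0 (a - t * b)); lra.
  have : - (`|a * b| * `|D2 k l z|) <= a * (b * D2 k l z).
    by rewrite mulrA -normrM lerNl -normrN ler_norm.
  apply: le_trans; rewrite lerN2 [leRHS]mulrC; exact: ler_pM.
pose blk (x y : bool) := \sum_i ps_coord v (y, i) *
  (\sum_j ps_coord v (x, j) * D2 (x, j) (y, i) z).
have -> : quad z v = (blk true true + blk false true)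
    + (blk true false + blk false false).
  rewrite /quad [LHS]sum_boolpair /blk; congr (_ + _).
    by rewrite -big_split; apply: eq_bigr => i _; rewrite sum_boolpair mulrDr.
  by rewrite -big_split; apply: eq_bigr => i _; rewrite sum_boolpair mulrDr.
have hq : th * sq v.2 <= blk true true := hth z v.2 zK.
have sumb (a b : 'rV[R]_N) (e : R) (x y : bool) : 0 < e ->
   - (C * N%:R * (e * sq a + (4 * e)^-1 * sq b)) <=
   \sum_i a 0 i * (\sum_j b 0 j * D2 (x, j) (y, i) z).
  move=> e0.
  apply: (@le_trans _ _ (\sum_(i < N) \sum_(j < N)
      - (C * (e * a 0 i ^+ 2 + (4 * e)^-1 * b 0 j ^+ 2)))).
    have e1 i : \sum_(j < N) - (C * (e * a 0 i ^+ 2 + (4 * e)^-1 * b 0 j ^+ 2)) =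
        - (C * N%:R * e) * a 0 i ^+ 2 - C * ((4 * e)^-1 * sq b).
      rewrite sumrN -mulr_sumr big_split /= sumr_const card_ord -mulr_sumr -/(sq b).
      by rewrite -mulr_natl; ring.
    rewrite (eq_bigr _ (fun i _ => e1 i)) big_split /= -mulr_sumr sumr_const.
    by rewrite card_ord -/(sq a) -mulr_natl; lra.
  apply: ler_sum => i _; rewrite mulr_sumr; apply: ler_sum => j _.
  exact: bnd.
have b1 : _ <= blk false true := sumb v.2 v.1 _ false true et0.
have et1 : 0 < (4 * et)^-1 by rewrite invr_gt0 mulr_gt0.
have b2 : _ <= blk true false := sumb v.1 v.2 _ true false et1.
have h4 : (4 * (4 * et)^-1)^-1 = et by field; rewrite gt_eqF.
rewrite h4 in b2.
have h2 : 0 < (2 : R)^-1 by rewrite invr_gt0.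
have b3 : _ <= blk false false := sumb v.1 v.1 _ false false h2.
have eC : C * N%:R * et = th / 4 by rewrite /et; field; rewrite !gt_eqF.
have e12 : (4 * et)^-1 = (2 * et)^-1 / 2 by field; rewrite gt_eqF.
have e44 : (4 * (2 : R)^-1)^-1 = 2^-1 by field.
rewrite e44 in b3; rewrite e12 in b1 b2.
have hC2 : C * N%:R * (et * sq v.2) = th / 4 * sq v.2 by rewrite mulrA eC.
move: (blk true true) (blk false true) (blk true false) (blk false false)
  hq b1 b2 b3 hC2 => b11 b12 b21 b22.
clear; move: (sq v.1) (sq v.2) (2 * et)^-1 => s1 s2 ie.
move: (N%:R) => n hq b1 b2 b3 hC2.
rewrite mulrDr in b1; rewrite mulrDr in b2; rewrite mulrDr in b3.
by lra.
Qed.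

(** Positions and momenta vary together along the segment, so the whole Hessian of [F] enters; only
    its momentum block is positive, and the others are paid for by [C * sq (x - z)]. *)
Lemma local_strong_convexity x0 p0 r s : 0 <= r -> 0 <= s ->
  exists2 th : R, 0 < th & exists2 C : R, 0 < C &
  forall (x z p q : 'rV[R]_N) (l : R), 0 <= l <= 1 ->
    box x0 r x -> box x0 r z -> box p0 s p -> box p0 s q ->
    l * (1 - l) * (th * sq (p - q) - C * sq (x - z)) <=
    l * F (x, p) + (1 - l) * F (z, q)
      - F (l *: x + (1 - l) *: z, l *: p + (1 - l) *: q).
Proof.
move=> r0 s0; have [th th0 [C C0 h]] := quad_lower x0 p0 r0 s0.
exists (th / 2); first by lra.
exists (C / 2); first by lra.
move=> x z p q l l01 hx hz hp hq.
have e1 (a b : 'rV[R]_N) (t : R) :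
    l *: a + (1 - l) *: b + t *: (a - b) = (l + t) *: a + (1 - (l + t)) *: b.
  by apply/rowP => j; rewrite !mxE; ring.
have := @second_order_line (l *: x + (1 - l) *: z) (x - z)
  (l *: p + (1 - l) *: q) (p - q) l (th * sq (p - q) - C * sq (x - z)) l01.
have -> : (th * sq (p - q) - C * sq (x - z)) / 2 =
  th / 2 * sq (p - q) - C / 2 * sq (x - z) by lra.
have ex (a b : 'rV[R]_N) : l *: a + (1 - l) *: b + (1 - l) *: (a - b) = a.
  by apply/rowP => j; rewrite !mxE; ring.
have ez (a b : 'rV[R]_N) : l *: a + (1 - l) *: b - l *: (a - b) = b.
  by apply/rowP => j; rewrite !mxE; ring.
rewrite !ex !ez; apply => t /andP[t0 t1]; rewrite !e1.
have lt01 : 0 <= l + t <= 1 by apply/andP; split; lra.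
apply: (h _ (x - z, p - q)).
by split => /=; apply: box_convex.
Qed.

End local_bounds.

(** * The solution and the penalty terms *)

Lemma max_family (R : realType) (T : topologicalType) (I : finType) (K : set T)
    (f : I -> T -> R) (i0 : I) : K !=set0 -> compact K ->
  (forall i, continuous (f i)) ->
  exists i z, K z /\ forall j w, K w -> f j w <= f i z.
Proof.
move=> K0 cK cf.
have h i : exists z, K z /\ forall w, K w -> f i w <= f i z.
  have [z zK hz] := compact_EVT_max K0 cK (continuous_subspaceT (cf i)).
  exists z; split; first by rewrite inE in zK.
  by move=> w wK; apply: hz; rewrite inE.
pose z i := projT1 (cid (h i)).
have hz i : K (z i) /\ forall w, K w -> f i w <= f i (z i) := projT2 (cid (h i)).
have [i _ hi] := @arg_maxP _ _ _ i0 xpredT (fun i => f i (z i)) isT.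
exists i, (z i); split; first exact: (hz i).1.
by move=> j w wK; apply: le_trans ((hz j).2 w wK) _; exact: hi.
Qed.

(** Zero row sums allow [w i] to be subtracted from every entry; the off-diagonal terms are then
    products of two nonpositive numbers and the diagonal one vanishes. *)
Lemma coupling_max (R : realType) (m : nat) (B : 'M[R]_m) (w : 'I_m -> R) i :
  coupling_matrix B -> (forall j, w j <= w i) -> 0 <= \sum_j B i j * w j.
Proof.
move=> hB hw.
have -> : \sum_j B i j * w j = \sum_j B i j * (w j - w i).
  under [RHS]eq_bigr do rewrite mulrBr.
  by rewrite sumrB -mulr_suml (coupling_row_sum hB) mul0r subr0.
apply: sumr_ge0 => j _; have [->|ji] := eqVneq j i; first by rewrite subrr mulr0.
by apply: mulr_le0; [exact: coupling_offdiag|rewrite subr_le0].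
Qed.

Section continuity.
Context {R : realType} {T : topologicalType}.
Implicit Types f g : T -> R.

Lemma cont_cst (U : topologicalType) (a : U) : continuous (fun _ : T => a).
Proof. by move=> x; exact: cvg_cst. Qed.

Lemma cont_comp (U W : topologicalType) (f : T -> U) (g : U -> W) :
  continuous f -> continuous g -> continuous (fun x => g (f x)).
Proof. by move=> cf cg x; apply: continuous_comp; [exact: cf|exact: cg]. Qed.

Lemma contD f g : continuous f -> continuous g -> continuous (fun x => f x + g x).
Proof. by move=> cf cg x; apply: cvgD; [exact: cf|exact: cg]. Qed.

Lemma contB f g : continuous f -> continuous g -> continuous (fun x => f x - g x).
Proof. by move=> cf cg x; apply: cvgB; [exact: cf|exact: cg]. Qed.

Lemma contDv (V : normedModType R) (f g : T -> V) :
  continuous f -> continuous g -> continuous (fun x => f x + g x).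
Proof. by move=> cf cg x; apply: cvgD; [exact: cf|exact: cg]. Qed.

Lemma contBv (V : normedModType R) (f g : T -> V) :
  continuous f -> continuous g -> continuous (fun x => f x - g x).
Proof. by move=> cf cg x; apply: cvgB; [exact: cf|exact: cg]. Qed.

Lemma contZv (V : normedModType R) (a : R) (f : T -> V) :
  continuous f -> continuous (fun x => a *: f x).
Proof. by move=> cf x; apply: cvgZr; exact: cf. Qed.

Lemma cont_norm f : continuous f -> continuous (fun x => `|f x|).
Proof.
by move=> cf; apply: (@cont_comp _ _ f (fun r => `|r|)) => //; exact: norm_continuous.
Qed.

Lemma cont_coord n (f : T -> 'rV[R]_n) j :
  continuous f -> continuous (fun x => f x 0 j).
Proof.
move=> cf; apply: (@cont_comp _ _ f (fun v => v 0 j)) => //.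
exact: coord_continuous.
Qed.

Lemma cont_sqrt f : continuous f -> continuous (fun x => Num.sqrt (f x)).
Proof.
by move=> cf; apply: (@cont_comp _ _ f Num.sqrt) => //; exact: sqrt_continuous.
Qed.

Lemma cont_max0 f : continuous f -> continuous (fun x => Num.max 0 (f x)).
Proof.
move=> cf x; apply: (@continuous_max _ _ (cst 0) f); first exact: cvg_cst.
exact: cf.
Qed.

Lemma contM f g : continuous f -> continuous g -> continuous (fun x => f x * g x).
Proof. by move=> cf cg x; apply: cvgM; [exact: cf|exact: cg]. Qed.

Lemma contX2 f : continuous f -> continuous (fun x => f x ^+ 2).
Proof. by move=> cf; under eq_fun do rewrite expr2; exact: contM. Qed.

Lemma cont_fst (U W : topologicalType) : continuous (@fst U W).
Proof. by move=> x; exact: cvg_fst. Qed.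

Lemma cont_snd (U W : topologicalType) : continuous (@snd U W).
Proof. by move=> x; exact: cvg_snd. Qed.

Lemma near_gt f z (a : R) : continuous f -> a < f z -> \forall w \near z, a < f w.
Proof. by move=> cf; apply: cvgr_gt; exact: cf. Qed.

Lemma near_lt f z (a : R) : continuous f -> f z < a -> \forall w \near z, f w < a.
Proof. by move=> cf; apply: cvgr_lt; exact: cf. Qed.

End continuity.

Section solution.
Context {R : realType} {N m : nat} {H : 'I_m -> 'rV[R]_N -> 'rV[R]_N -> R}
  {B : 'M[R]_m} {u0 : 'rV[R]_N -> 'cV[R]_m} {u : R * 'rV[R]_N -> 'cV[R]_m}.
Hypothesis hu0l : lipschitz u0.
Hypothesis hu : is_cauchy_solution H B u0 u.

(* The solution is only continuous on nonnegative times; freezing it at time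
   [0] for negative times gives a continuous function on the whole space. *)
Definition ext (i : 'I_m) (z : R * 'rV[R]_N) : R := u (Num.max 0 z.1, z.2) i 0.

Lemma extE i (t : R) x : 0 <= t -> ext i (t, x) = u (t, x) i 0.
Proof. by move=> t0; rewrite /ext /= max_r. Qed.

Lemma ext_continuous i : continuous (ext i).
Proof.
have [/subspace_continuousP cu _] := cauchy_viscosity hu.
move=> z; pose c (z : R * 'rV[R]_N) := (Num.max 0 z.1, z.2).
have cA w : (`[0, +oo[ `*` setT) (c w).
  by split => //=; rewrite in_itv /= andbT le_max lexx.
have c1 : continuous (fun w : R * 'rV[R]_N => Num.max 0 w.1).
  by apply: cont_max0; exact: cont_fst.
have cc : c @ z --> c z by exact: (cvg_pair (c1 z) (@cvg_snd _ _ _ _ _)).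
have cw : c @ z --> within (`[0, +oo[ `*` setT) (nbhs (c z)).
  move=> W hW; change (nbhs z (c @^-1` W)).
  have hc : nbhs z (c @^-1` [set w | (`[0, +oo[ `*` setT) w -> W w]) := cc _ hW.
  by apply: filterS hc => w; apply.
have h1 : u \o c @ z --> u (c z) by apply: cvg_comp cw (cu _ (cA z)).
exact: (cvg_comp _ _ h1 (@coord_continuous _ _ _ i 0 (u (c z)))).
Qed.

Lemma sol_bounded (T : R) : 0 < T -> exists2 C : R, 1 <= C &
  forall i (t : R) x, 0 <= t <= T -> `|ext i (t, x)| <= C.
Proof.
move=> T0; have [M [_ hM]] := cauchy_bounded hu T0.
exists (`|M| + 1) => [|i t x tT]; first by rewrite lerDr.
rewrite extE; last by case/andP: tT.
apply: (le_trans (coord_le_norm _ _ _)).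
apply: (hM _ _ (t, x)); first by rewrite (le_lt_trans (ler_norm M))// ltrDl.
by split => //=; rewrite in_itv.
Qed.

Lemma sol_unif (T e : R) : 0 < T -> 0 < e -> exists2 d : R, 0 < d &
  forall i (t s : R) (x y : 'rV[R]_N), 0 <= t <= T -> 0 <= s <= T -> `|t - s| < d ->
    (forall j, `|x 0 j - y 0 j| < d) -> `|ext i (t, x) - ext i (s, y)| < e.
Proof.
move=> T0 e0; have /unif_continuous_onP /(_ e e0) [d d0 hd] :=
  cauchy_unif_continuous hu T0.
exists d => // i t s x y tT sT ts xy.
rewrite !extE; try by [case/andP: tT|case/andP: sT].
have : ball (u (t, x)) e (u (s, y)).
  apply: hd; [by split => //=; rewrite in_itv|by split => //=; rewrite in_itv|].
  split; rewrite -ball_normE //=; apply: norm_lt_coord => // j.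
  by rewrite !mxE; exact: xy.
rewrite -ball_normE /=.
by apply: le_lt_trans; apply: (le_trans _ (coord_le_norm _ i 0)); rewrite !mxE.
Qed.

Lemma init_lipschitz : exists2 L : R, 1 <= L &
  forall i x y, `|ext i (0, x) - ext i (0, y)| <= L * enorm (x - y).
Proof.
have [M [_ hM]] := hu0l.
exists (`|M| + 1) => [|i x y]; first by rewrite lerDr.
rewrite !extE// !(cauchy_initial hu).
have M1 : M < `|M| + 1 by rewrite (le_lt_trans (ler_norm M))// ltrDl.
have := hM _ M1 (x, y); rewrite /= => /(_ (conj I I)) h.
have -> : u0 x i 0 - u0 y i 0 = (u0 x - u0 y) i 0 by rewrite !mxE.
apply: (le_trans (coord_le_norm _ _ _)); apply: (le_trans h).
apply: ler_wpM2l; first by rewrite addr_ge0.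
(* [lipschitz] refers to the sup norm, which the Euclidean norm dominates. *)
rewrite leNgt; apply/negP => hlt.
have n0 := le_lt_trans (enorm_ge0 (x - y)) hlt.
suff : `|x - y| < `|x - y| by rewrite ltxx.
apply: norm_lt_coord => // j; apply: le_lt_trans hlt.
by apply: coord_le_sq; rewrite ?enorm_ge0// enorm_sq.
Qed.

Lemma coupling_bounded (T : R) : 0 < T -> exists2 C : R, 0 <= C &
  forall i (t : R) x, 0 <= t <= T -> `|\sum_j B i j * ext j (t, x)| <= C.
Proof.
move=> T0; have [C C1 hC] := sol_bounded T0.
exists (\sum_i \sum_j `|B i j| * C) => [|i t x tT].
  by apply: sumr_ge0 => i _; apply: sumr_ge0 => j _; rewrite mulr_ge0// (le_trans _ C1).
apply: (@le_trans _ _ (\sum_j `|B i j| * C)).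
  apply: (le_trans (ler_norm_sum _ _ _)); apply: ler_sum => j _.
  by rewrite normrM ler_wpM2l// hC.
rewrite [leRHS](bigD1 i)//= lerDl; apply: sumr_ge0 => k _.
by apply: sumr_ge0 => j _; rewrite mulr_ge0// (le_trans _ C1).
Qed.

Lemma ext_sub_jet (i : 'I_m) (t : R) (x : 'rV[R]_N) (a : R) (p : 'rV[R]_N) (M : R) :
  0 < t ->
  (\forall z \near (t, x), ext i z <= ext i (t, x) + quad_test t x a M p z) ->
  a + H i x p + \sum_j B i j * ext j (t, x) <= 0.
Proof.
move=> t0 h; under eq_bigr do rewrite extE ?ltW//.
apply: (sub_jet (cauchy_viscosity hu) (M := M) t0).
have tz : \forall z \near (t, x), 0 < z.1.
  by apply: (near_gt (@cont_fst R 'rV[R]_N)); rewrite /=.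
apply: filterS2 tz h => -[s y] /= s0; rewrite !extE//; exact: ltW.
Qed.

Lemma ext_super_jet (i : 'I_m) (t : R) (x : 'rV[R]_N) (a : R) (p : 'rV[R]_N) (M : R) :
  0 < t ->
  (\forall z \near (t, x), ext i (t, x) + quad_test t x a M p z <= ext i z) ->
  0 <= a + H i x p + \sum_j B i j * ext j (t, x).
Proof.
move=> t0 h; under eq_bigr do rewrite extE ?ltW//.
apply: (super_jet (cauchy_viscosity hu) (M := M) t0).
have tz : \forall z \near (t, x), 0 < z.1.
  by apply: (near_gt (@cont_fst R 'rV[R]_N)); rewrite /=.
apply: filterS2 tz h => -[s y] /= s0; rewrite !extE//; exact: ltW.
Qed.

End solution.

Arguments ext {R N m} u i z.

(** Maxima are taken over compact cylinders; at a maximum point strictly inside, this turns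
    maximality into the local inequality that the jets require. *)
Lemma near_cylinder (R : realType) (n : nat) (a b r t : R) (x y : 'rV[R]_n) :
  a < t < b -> (forall j, `|x 0 j - y 0 j| < r) ->
  \forall z \near (t, x), a <= z.1 <= b /\ box y r z.2.
Proof.
move=> /andP[a_t tb] xy.
have h1 : \forall z \near (t, x), a < z.1.
  by apply: (near_gt (@cont_fst R 'rV[R]_n)); rewrite /=.
have h2 : \forall z \near (t, x), z.1 < b.
  by apply: (near_lt (@cont_fst R 'rV[R]_n)); rewrite /=.
have h3 : \forall z \near (t, x), forall j, `|(z.2 : 'rV[R]_n) 0 j - y 0 j| < r.
  have := @filter_forall _ _ (fun j => [set z : R * 'rV[R]_n | `|z.2 0 j - y 0 j| < r])
    (nbhs (t, x)) _; apply => j.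
  have : continuous (fun z : R * 'rV[R]_n => `|z.2 0 j - y 0 j|).
    apply: cont_norm; apply: contB; last exact: cont_cst.
    by apply: cont_coord; exact: cont_snd.
  move=> c.
  exact: (@near_lt _ _ (fun z : R * 'rV[R]_n => `|z.2 0 j - y 0 j|) (t, x) r c (xy j)).
near=> z; split; last by move=> j; apply: ltW; move: j; near: z.
by apply/andP; split; apply: ltW; near: z.
Unshelve. all: by end_near.
Qed.

(** * One-sided quadratic expansions of the penalty functions *)

Section penalties.
Context {R : realType}.
Implicit Types a b v w : R.

(** The concave square root lies below its tangent at [v]. *)
Lemma sqrt_jet v w : 0 < v -> 0 <= w ->
  Num.sqrt w <= Num.sqrt v + (w - v) / (2 * Num.sqrt v).
Proof.
move=> v0 w0; have s0 : 0 < Num.sqrt v by rewrite sqrtr_gt0.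
rewrite -lerBlDl ler_pdivlMr ?mulr_gt0//.
have -> : w - v = Num.sqrt w ^+ 2 - Num.sqrt v ^+ 2 by rewrite !sqr_sqrtr// ltW.
have := sqr_ge0 (Num.sqrt w - Num.sqrt v); lra.
Qed.

(** The squared positive part is C^1 with a 2-Lipschitz derivative, which makes it a cutoff that
    admits upper paraboloids everywhere. *)
Lemma pos_sqr_jet a b : Num.max 0 b ^+ 2 <=
  Num.max 0 a ^+ 2 + 2 * Num.max 0 a * (b - a) + (b - a) ^+ 2.
Proof.
have [b0|b0] := leP 0 b; have [a0|a0] := leP 0 a.
- nra.
- nra.
- have := sqr_ge0 b; nra.
- have := sqr_ge0 (b - a); nra.
Qed.

Lemma sqrt_add_ge (a e : R) : `|a| <= Num.sqrt (a ^+ 2 + e ^+ 2).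
Proof. by rewrite -sqrtr_sqr ler_sqrt ?lerDl ?addr_ge0 ?sqr_ge0. Qed.

Lemma sqrt_add_le (a e : R) : 0 <= e ->
  Num.sqrt (a ^+ 2 + e ^+ 2) <= `|a| + e.
Proof.
move=> e0; rewrite -[leRHS]ger0_norm ?addr_ge0// -sqrtr_sqr ler_sqrt ?sqr_ge0//.
rewrite sqrrD real_normK ?num_real// lerD2r lerDl.
by rewrite mulrn_wge0// mulr_ge0.
Qed.

End penalties.

(** * Lipschitz continuity in time *)

Lemma enorm_sqrt (R : realType) n (x : 'rV[R]_n) : enorm x = Num.sqrt (sq x).
Proof. by []. Qed.

Lemma sq_shift (R : realType) n (x y z : 'rV[R]_n) :
  sq (z - y) = sq (x - y) + 2 * dot (x - y) (z - x) + sq (z - x).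
Proof. by rewrite -sqD; congr sq; apply/rowP => j; rewrite !mxE; ring. Qed.

Lemma coord_le_sqrt (R : realType) n (x : 'rV[R]_n) e j :
  `|x 0 j| <= Num.sqrt (sq x + e ^+ 2).
Proof.
rewrite -sqrtr_sqr ler_sqrt ?addr_ge0 ?sq_ge0 ?sqr_ge0//.
by rewrite (le_trans (sq_coord x j))// lerDl sqr_ge0.
Qed.

Lemma compact_cylinder (R : realType) n (a b r : R) (y : 'rV[R]_n) :
  compact (`[a, b] `*` box y r).
Proof. by apply: compact_setX; [exact: segment_compact|exact: compact_box]. Qed.

(* Maximise [v - A t - L sqrt (|x - y|^2 + e^2)] minus a cutoff [g] that keeps
   the maximum away from the final time. *)
Lemma barrier_touch (R : realType) (n : nat) (v : R * 'rV[R]_n -> R)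
    (A C L T t1 : R) (y : 'rV[R]_n) :
  continuous v -> 0 <= A -> 1 <= C -> 1 <= L ->
  (forall t x, 0 <= t <= T + 1 -> `|v (t, x)| <= C) ->
  (forall x, v (0, x) <= v (0, y) + L * enorm (x - y)) ->
  0 <= t1 <= T -> v (0, y) + A * t1 < v (t1, y) ->
  exists t x a M p, [/\ 0 < t <= T + 1, A <= a, sq p <= L ^+ 2 &
    \forall z \near (t, x), v z <= v (t, x) + quad_test t x a M p z].
Proof.
move=> cv A0 C1 L1 hC hL /andP[t10 t1T] hlt.
pose E : R := v (t1, y) - v (0, y) - A * t1.
have E0 : 0 < E by rewrite /E; lra.
(* The smoothing costs [L * e] at the centre, that is half of the excess [E]. *)
pose e : R := E / (2 * L).
have L0 : 0 < L by lra.
have e0 : 0 < e by rewrite divr_gt0// mulr_gt0.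
have Le : L * e = E / 2 by rewrite /e; field; rewrite gt_eqF.
pose P (x : 'rV[R]_n) : R := Num.sqrt (sq (x - y) + e ^+ 2).
(* Larger than the oscillation [2 * C] of [v]: neither the cutoff, equal to [k] at time [T + 1], nor
   the cone, at least [k] on the lateral boundary since [1 <= L], can be paid for at a maximum. *)
pose k : R := 2 * C + 1.
have k0 : 0 < k by rewrite /k; lra.
pose g (t : R) : R := k * Num.max 0 (t - T) ^+ 2.
pose Phi (z : R * 'rV[R]_n) : R := v z - A * z.1 - L * P z.2 - g z.1.
have cPhi : continuous Phi.
  have cP : continuous (fun z : R * 'rV[R]_n => P z.2).
    apply: cont_sqrt; apply: contD; last exact: cont_cst.
    by apply: continuous_sq; apply: contBv; [exact: cont_snd|exact: cont_cst].
  apply: contB; first apply: contB; first apply: contB => //.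
  - by apply: contM; [exact: cont_cst|exact: cont_fst].
  - by apply: contM; [exact: cont_cst|].
  - apply: contM; first exact: cont_cst.
    by apply: contX2; apply: cont_max0; apply: contB; [exact: cont_fst|exact: cont_cst].
pose K := `[0, T + 1] `*` box y k.
have t1K : K (t1, y).
  by split => /=; [rewrite in_itv/= t10/=; lra|apply: box_center; rewrite /k; lra].
have [_ [[t x] [[/= tT xk] hmax]]] := @max_family R _ 'I_1 K (fun=> Phi) ord0
  (ex_intro _ _ t1K) (@compact_cylinder _ _ _ _ _ _) (fun=> cPhi).
move: tT; rewrite in_itv /= => /andP[t0 tT].
have P0 (z : 'rV[R]_n) : 0 <= P z by exact: sqrtr_ge0.
have Px0 : 0 < P x.
  by rewrite /P sqrtr_gt0 ltr_wpDl ?sq_ge0// exprn_gt0.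
have g0 (s : R) : 0 <= g s by rewrite /g mulr_ge0 ?sqr_ge0 ?ltW.
have Phi1 : v (0, y) + E / 2 <= Phi (t, x).
  apply: le_trans (hmax ord0 _ t1K); rewrite /Phi /= /P /g subrr sq0 add0r.
  rewrite sqrtr_sqr gtr0_norm// Le max_l; last by lra.
  by rewrite expr0n mulr0 /E; lra.
have hv0 : - C <= v (0, y).
  have : `|v (0, y)| <= C by apply: hC; rewrite lexx/=; lra.
  by rewrite ler_norml => /andP[].
have hvt : v (t, x) <= C.
  have : `|v (t, x)| <= C by apply: hC; rewrite t0.
  by rewrite ler_norml => /andP[].
have At0 : 0 <= A * t by exact: mulr_ge0.
have LP0 : 0 <= L * P x by rewrite mulr_ge0// ltW.
(* At time 0 the Lipschitz cone already lies above [v], so the value of [Phi] could not exceed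
   [v (0, y)]. *)
have tpos : 0 < t.
  rewrite lt_neqAle t0 andbT; apply/eqP => t00.
  have := hL x; have := g0 t; move: Phi1 At0; rewrite /Phi /= -t00 => h1 h2 h3 h4.
  have : enorm (x - y) <= P x.
    by rewrite enorm_sqrt /P ler_sqrt ?lerDl ?addr_ge0 ?sq_ge0 ?sqr_ge0.
  rewrite -(ler_pM2l L0); lra.
have tlt : t < T + 1.
  rewrite lt_neqAle tT andbT; apply/eqP => t11.
  have gT : g (T + 1) = k by rewrite /g addrAC subrr add0r max_r// expr1n mulr1.
  move: Phi1 LP0 At0 hvt; rewrite /Phi /= t11 gT /k; lra.
have xlt j : `|x 0 j - y 0 j| < k.
  have := xk j; rewrite le_eqVlt => /orP[/eqP xe|//].
  have := coord_le_sqrt (x - y) e j; rewrite !mxE xe -/(P x) => kP.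
  have : k <= L * P x by apply: (le_trans kP); rewrite ler_peMl.
  move: Phi1 (g0 t); rewrite /Phi /= /k; lra.
have tlt2 : 0 < t < T + 1 by rewrite tpos.
exists t, x, (A + 2 * k * Num.max 0 (t - T)), (L / (2 * P x) + k),
  ((L / P x) *: (x - y)); split.
- by rewrite tpos.
- by rewrite lerDl mulr_ge0 ?le_max ?lexx// mulr_ge0// /k; lra.
- rewrite sqZ expr_div_n mulrAC ler_pdivrMr ?exprn_gt0// ler_pM2l ?exprn_gt0//.
  by rewrite sqr_sqrtr ?lerDl ?addr_ge0 ?sq_ge0 ?sqr_ge0.
near=> z.
have zK : K z.
  have : 0 <= z.1 <= T + 1 /\ box y k z.2 by near: z; exact: near_cylinder.
  by case=> h1 h2; split => //=; rewrite in_itv.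
have := hmax ord0 z zK; rewrite /Phi /= => hz.
have Pz : P z.2 <= P x + (2 * dot (x - y) (z.2 - x) + sq (z.2 - x)) / (2 * P x).
  apply: (le_trans (@sqrt_jet _ (sq (x - y) + e ^+ 2) _ _ _)).
  - by rewrite -sqrtr_gt0.
  - by rewrite addr_ge0 ?sq_ge0 ?sqr_ge0.
  rewrite -/(P x) (sq_shift x y z.2) lerD2l ler_pM2r ?invr_gt0 ?mulr_gt0//; lra.
have gz : g z.1 <= g t + k * (2 * Num.max 0 (t - T) * (z.1 - t) + (z.1 - t) ^+ 2).
  have := pos_sqr_jet (t - T) (z.1 - T).
  have -> : z.1 - T - (t - T) = z.1 - t by ring.
  by rewrite -addrA -(ler_pM2l k0) mulrDr.
have LPz : L * P z.2 <= L * P x +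
    L * ((2 * dot (x - y) (z.2 - x) + sq (z.2 - x)) / (2 * P x)).
  by rewrite -mulrDr ler_pM2l.
have eD : L * ((2 * dot (x - y) (z.2 - x) + sq (z.2 - x)) / (2 * P x)) =
    L / P x * dot (x - y) (z.2 - x) + L / (2 * P x) * sq (z.2 - x).
  by field; rewrite gt_eqF.
rewrite eD in LPz.
rewrite /quad_test dotZl.
have m1 : 0 <= k * sq (z.2 - x) by rewrite mulr_ge0 ?sq_ge0 ?ltW.
have m2 : 0 <= L / (2 * P x) * (z.1 - t) ^+ 2.
  by rewrite mulr_ge0 ?sqr_ge0// divr_ge0 ?mulr_ge0// ltW.
move: hz LPz gz m1 m2; clear.
move: (L / (2 * P x)) (L / P x * _) (Num.max 0 (t - T)) => a b c.
move: (v z) (v (t, x)) (sq _) (P z.2) (P x) (g z.1) (g t) (z.1) => *; lra.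
Unshelve. all: by end_near.
Qed.

Section initial_layer.
Context {R : realType} {N m : nat} {H : 'I_m -> 'rV[R]_N -> 'rV[R]_N -> R}
  {B : 'M[R]_m} {u0 : 'rV[R]_N -> 'cV[R]_m} {u : R * 'rV[R]_N -> 'cV[R]_m}.
Hypothesis hH : standing_hamiltonians H.
Hypothesis hu0l : lipschitz u0.
Hypothesis hu : is_cauchy_solution H B u0 u.
Local Notation v := (ext u).

(** The upper estimate contradicts the subsolution inequality with the global lower bound of the
    Hamiltonians. The lower one applies the barrier to the opposite function; there the gradient
    bound [L] of the cone is what bounds the Hamiltonian from above. *)
Lemma initial_layer (T : R) : 0 < T -> exists2 A : R, 0 <= A &
  forall i t x, 0 <= t <= T -> `|v i (t, x) - v i (0, x)| <= A * t.
Proof.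
move=> T0; have T10 : 0 < T + 1 by lra.
have [C C1 hC] := sol_bounded hu T10.
have [Cb Cb0 hCb] := coupling_bounded hu T10.
have [L L1 hL] := init_lipschitz hu0l hu.
have [h h0 hh] := ham_ge hH.
have [k k0 hk] := ham_le hH L.
(* A time slope of this size outweighs the Hamiltonian and the coupling in both inequalities; the
   final 1 makes the contradictions strict. *)
exists (h + k + Cb + 1); first by lra.
set A := h + k + Cb + 1.
have A0 : 0 <= A by rewrite /A; lra.
move=> i t x tT; rewrite ler_norml; apply/andP; split; rewrite leNgt; apply/negP => hlt.
- have cv : continuous (fun z => - v i z).
    by move=> z; apply: cvgN; exact: (ext_continuous hu).
  have hCN s y : 0 <= s <= T + 1 -> `|- v i (s, y)| <= C.
    by move=> sT; rewrite normrN; exact: hC.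
  have hLN y : - v i (0, y) <= - v i (0, x) + L * enorm (y - x).
    have := hL i y x; rewrite ler_norml => /andP[]; lra.
  have hltN : - v i (0, x) + A * t < - v i (t, x) by move: hlt; lra.
  have [s [y [a [M [p [s0 Aa pL hj]]]]]] :=
    barrier_touch cv A0 C1 L1 hCN hLN tT hltN.
  have := @ext_super_jet _ _ _ _ _ _ _ hu i s y (- a) (- p) (- M).
  case/andP: s0 => s0 sT1; move=> /(_ s0).
  have hj' : \forall z \near (s, y), v i (s, y) + quad_test s y (- a) (- M) (- p) z <= v i z.
    apply: filterS hj => z; rewrite /quad_test dotNl; lra.
  move=> /(_ hj'); have := hk i y (- p); rewrite sqN => /(_ pL).
  have := hCb i s y; rewrite (ltW s0) sT1 => /(_ isT); rewrite ler_norml => /andP[_].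
  move: Aa; rewrite /A; lra.
- have hLP y : v i (0, y) <= v i (0, x) + L * enorm (y - x).
    have := hL i y x; rewrite ler_norml => /andP[]; lra.
  have hltP : v i (0, x) + A * t < v i (t, x) by move: hlt; lra.
  have [s [y [a [M [p [s0 Aa pL hj]]]]]] :=
    barrier_touch (@ext_continuous _ _ _ _ _ _ _ hu i) A0 C1 L1 (hC i) hLP tT hltP.
  have := @ext_sub_jet _ _ _ _ _ _ _ hu i s y a p M.
  case/andP: s0 => s0 sT1; move=> /(_ s0 hj).
  have := hh i y p.
  have := hCb i s y; rewrite (ltW s0) sT1 => /(_ isT); rewrite ler_norml => /andP[+ _].
  move: Aa; rewrite /A; lra.
Qed.

End initial_layer.

Lemma uniform_pos (R : realType) (I : finType) (P : I -> R -> Prop) :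
  (forall i, exists2 d, 0 < d & P i d) ->
  (forall i d d', 0 < d' -> d' <= d -> P i d -> P i d') ->
  exists2 d, 0 < d & forall i, P i d.
Proof.
move=> hP mono; pose d i := s2val (cid2 (hP i)).
have d0 i : 0 < d i := s2valP (cid2 (hP i)).
have hd i : P i (d i) := s2valP' (cid2 (hP i)).
have m0 : 0 < \big[Order.min/1]_i d i.
  by apply/bigmin_gtP; split => // i _; exact: d0.
by exists (\big[Order.min/1]_i d i) => // i; apply: mono (hd i) => //; exact: bigmin_le.
Qed.

(** Meets all the smallness conditions on a penalisation parameter at once. *)
Lemma small_eps (R : realType) (c : R) (s : seq R) : 0 <= c ->
  (forall b, b \in s -> 0 < b) ->
  exists2 e, 0 < e & forall b, b \in s -> c * e < b.
Proof.
move=> c0; elim: s => [_|b s IH hs]; first by exists 1.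
have [b' b's|e e0 he] := IH; first by apply: hs; rewrite inE b's orbT.
have b0 : 0 < b by apply: hs; rewrite mem_head.
have c1 : 0 < c + 1 by lra.
exists (Num.min e (b / (c + 1))); first by rewrite lt_min e0 divr_gt0.
move=> b'; rewrite inE => /predU1P[->|b's].
  apply: (@le_lt_trans _ _ (c * (b / (c + 1)))).
    by rewrite ler_wpM2l// ge_min lexx orbT.
  by rewrite mulrA ltr_pdivrMr//; lra.
apply: le_lt_trans (he _ b's); by rewrite ler_wpM2l// ge_min lexx.
Qed.

Lemma coord_lt_sq (R : realType) n (x : 'rV[R]_n) (r : R) j :
  0 < r -> sq x < r ^+ 2 -> `|x 0 j| < r.
Proof.
move=> r0 xr; have := le_lt_trans (sq_coord x j) xr.
by rewrite -(real_normK (num_real (x 0 j))) ltr_sqr ?nnegrE// ltW.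
Qed.

Lemma le_sqr_add1 (R : realType) (a : R) : 0 <= a -> a <= (a + 1) ^+ 2.
Proof. by move=> a0; nra. Qed.

Lemma time_lipschitz (R : realType) (N m : nat)
    (H : 'I_m -> 'rV[R]_N -> 'rV[R]_N -> R) (B : 'M[R]_m)
    (u0 : 'rV[R]_N -> 'cV[R]_m) (u : R * 'rV[R]_N -> 'cV[R]_m) (T : R) :
  standing_hamiltonians H -> coupling_matrix B -> lipschitz u0 ->
  is_cauchy_solution H B u0 u -> 0 < T -> exists2 A : R, 0 <= A &
  forall i (t s : R) x, 0 <= t <= T -> 0 <= s <= T ->
    ext u i (t, x) - ext u i (s, x) <= A * `|t - s|.
Proof.
move=> hH hB hu0l hu T0; have T10 : 0 < T + 1 by lra.
have [C C1 hC] := sol_bounded hu T10.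
have [Cb Cb0 hCb] := coupling_bounded hu T10.
have [A A0 hA] := initial_layer hH hu0l hu T10.
exists A => // i1 t1 s1 x1 /andP[t10 t1T] /andP[s10 s1T].
rewrite leNgt; apply/negP => hlt.
(* A quarter of the violation: the smoothing of the absolute value and the term [de * t] may each
   cost [Mq], so the maximum is still at least [2 * Mq]. *)
pose Mq : R := (ext u i1 (t1, x1) - ext u i1 (s1, x1) - A * `|t1 - s1|) / 4.
have Mq0 : 0 < Mq by rewrite /Mq; lra.
(* Subtracting [de * t] adds [de] to the time slope at [(t, x)], which makes the final comparison
   strict. *)
pose de : R := Mq / (T + 1).
have de0 : 0 < de by rewrite divr_gt0.
have [d d0 hd] := sol_unif hu T10 Mq0.
have [R0 R00 hR0] := ham_coercive hH (Cb + A).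
(* Leaves room for the second gradient, which differs from the first by a vector of length less than
   1. *)
pose r : R := 2 * R0 + 2.
have r0 : 0 < r by rewrite /r; lra.
have [d' d'0 hd'] : exists2 d' : R, 0 < d' & forall i,
    forall (x y p q : 'rV[R]_N), sq p < r ^+ 2 -> sq q < r ^+ 2 ->
    (forall j, `|x 0 j - y 0 j| < d') -> (forall j, `|p 0 j - q 0 j| < d') ->
    `|H i x p - H i y q| < de.
  apply: uniform_pos => [i|i a b b0 ba h x y p q pr qr xy pq].
    exact: (ham_unif hH i r0 de0).
  by apply: h => // j; apply: lt_le_trans ba.
have [||e e0 he] := @small_eps R (A + 16 * C) [:: Mq; d ^+ 2; 1; d' ^+ 2].
- lra.
- by move=> b; rewrite !inE => /or4P[] /eqP-> //; rewrite exprn_gt0.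
have Ce0 : 0 <= C * e by rewrite mulr_ge0 ?(ltW e0)//; lra.
have Ae0 : 0 <= A * e by rewrite mulr_ge0 ?(ltW e0).
have [he1 he2 he3 he4] : [/\ A * e < Mq, 2 * C * e < d ^+ 2, 16 * C * e < 1
    & 8 * C * e < d' ^+ 2].
  have [h1 [h2 [h3 h4]]] : (A + 16 * C) * e < Mq /\ (A + 16 * C) * e < d ^+ 2
      /\ (A + 16 * C) * e < 1 /\ (A + 16 * C) * e < d' ^+ 2.
    by do ![split]; apply: he; rewrite !inE eqxx ?orbT.
  by split; [move: h1|move: h2|move: h3|move: h4]; move: Ce0 Ae0; clear; lra.
clear he.
pose k : R := 2 * C + 1.
have k0 : 0 < k by rewrite /k; lra.
pose g (t : R) : R := k * Num.max 0 (t - T) ^+ 2.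
pose S (t s : R) : R := Num.sqrt ((t - s) ^+ 2 + e ^+ 2).
(* The term [e * sq (w.1.2 - x1)] replaces the missing compactness of the space, and the two [g]
   keep both times below [T + 1]. *)
pose Phi i (w : (R * 'rV[R]_N) * (R * 'rV[R]_N)) : R := ext u i w.1 - ext u i w.2
  - A * S w.1.1 w.2.1 - e^-1 * sq (w.1.2 - w.2.2) - e * sq (w.1.2 - x1)
  - de * w.1.1 - g w.1.1 - g w.2.1.
have cPhi i : continuous (Phi i).
  have c11 : continuous (fun w : (R * 'rV[R]_N) * (R * 'rV[R]_N) => w.1.1).
    by apply: cont_comp; exact: cont_fst.
  have c12 : continuous (fun w : (R * 'rV[R]_N) * (R * 'rV[R]_N) => w.1.2).
    by apply: cont_comp; [exact: cont_fst|exact: cont_snd].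
  have c21 : continuous (fun w : (R * 'rV[R]_N) * (R * 'rV[R]_N) => w.2.1).
    by apply: cont_comp; [exact: cont_snd|exact: cont_fst].
  have c22 : continuous (fun w : (R * 'rV[R]_N) * (R * 'rV[R]_N) => w.2.2).
    by apply: cont_comp; exact: cont_snd.
  have cg (f : (R * 'rV[R]_N) * (R * 'rV[R]_N) -> R) :
      continuous f -> continuous (fun w => g (f w)).
    move=> cf; apply: contM; first exact: cont_cst.
    by apply: contX2; apply: cont_max0; apply: contB => //; exact: cont_cst.
  apply: contB; last exact: cg.
  apply: contB; last exact: cg.
  apply: contB; last by apply: contM => //; exact: cont_cst.
  apply: contB; last first.
    apply: contM; first exact: cont_cst.
    by apply: continuous_sq; apply: contBv => //; exact: cont_cst.
  apply: contB; last first.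
    apply: contM; first exact: cont_cst.
    by apply: continuous_sq; exact: contBv.
  apply: contB; last first.
    apply: contM; first exact: cont_cst.
    apply: cont_sqrt; apply: contD; last exact: cont_cst.
    by apply: contX2; exact: contB.
  apply: contB.
    by apply: (cont_comp (@cont_fst _ _)); exact: (ext_continuous hu).
  by apply: (cont_comp (@cont_snd _ _)); exact: (ext_continuous hu).
(* At a maximum [sq (x - x1)] is at most [2 * C / e] and [sq (x - y)] at most [2 * C * e]; this
   radius keeps both points off the lateral boundary. *)
pose rho : R := 2 * C / e + 2 * C * e + 3.
have C0 : 0 <= 2 * C by move: C1; clear; lra.
have Cie0 : 0 <= 2 * C / e by rewrite divr_ge0 ?(ltW e0).
have Cee0 : 0 <= 2 * C * e by rewrite mulr_ge0 ?(ltW e0).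
pose K1 := `[0, T + 1] `*` box x1 rho.
pose K := K1 `*` K1.
have rho0 : 0 <= rho by rewrite /rho; move: Cie0 Cee0; clear; lra.
have PK : K ((t1, x1), (s1, x1)).
  have le1 a : a <= T -> a <= T + 1 by move/le_trans; apply; rewrite lerDl.
  by split; split => /=; rewrite ?in_itv/= ?t10 ?s10 ?le1//; exact: box_center.
have cK : compact K by apply: compact_setX; exact: compact_cylinder.
have [i [[[t x] [s y]] [[/= [tT xk] [sT yk]] hmax]]] :=
  @max_family R _ _ K Phi i1 (ex_intro _ _ PK) cK cPhi.
move: tT sT; rewrite /= !in_itv /= => /andP[t0 tT] /andP[s0 sT].

(* Location of the maximum point *)
have S0 : 0 < S t s by rewrite sqrtr_gt0 ltr_wpDl ?sqr_ge0// exprn_gt0.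
have g0 a : 0 <= g a by rewrite mulr_ge0 ?sqr_ge0 ?ltW.
have gT : g (T + 1) = k by rewrite /g addrAC subrr add0r max_r// expr1n mulr1.
have Phi1 : 2 * Mq <= Phi i ((t, x), (s, y)).
  apply: le_trans (hmax i1 _ PK); rewrite /Phi /= !subrr sq0 !mulr0 !subr0.
  rewrite /g !max_l ?subr_le0//.
  rewrite expr0n mulr0 !subr0.
  have h1 := ler_wpM2l A0 (sqrt_add_le (t1 - s1) (ltW e0)).
  rewrite -/(S t1 s1) mulrDr in h1.
  have h2 : de * t1 <= Mq.
    by rewrite /de mulrAC ler_pdivrMr// ler_pM2l// (le_trans t1T)// lerDl.
  have h3 : ext u i1 (t1, x1) - ext u i1 (s1, x1) - A * `|t1 - s1| = 4 * Mq.
    by rewrite /Mq; field.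
  by move: h1 h2 h3 he1; clear; lra.
have AS0 : 0 <= A * S t s by rewrite mulr_ge0// ltW.
have q10 : 0 <= e^-1 * sq (x - y) by rewrite mulr_ge0 ?sq_ge0// invr_ge0 ltW.
have q20 : 0 <= e * sq (x - x1) by rewrite mulr_ge0 ?sq_ge0 ?ltW.
have dt0 : 0 <= de * t by rewrite mulr_ge0// ltW.
have v1C : ext u i (t, x) <= C.
  have : `|ext u i (t, x)| <= C by apply: hC; rewrite t0.
  by rewrite ler_norml => /andP[].
have v2C : - C <= ext u i (s, y).
  have : `|ext u i (s, y)| <= C by apply: hC; rewrite s0.
  by rewrite ler_norml => /andP[].
have gt0 := g0 t; have gs0 := g0 s.
have Phi2 := Phi1; rewrite /Phi /= in Phi2.
have sqxy : sq (x - y) <= 2 * C * e.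
  rewrite mulrC -ler_pdivrMl//.
  by move: Phi2 v1C v2C AS0 q20 dt0 gt0 gs0 Mq0; clear; lra.
have sqx1 : e * sq (x - x1) <= 2 * C.
  by move: Phi2 v1C v2C AS0 q10 dt0 gt0 gs0 Mq0; clear; lra.
have tlt : t < T + 1.
  rewrite lt_neqAle tT andbT; apply/eqP => tE.
  by move: Phi2 v1C v2C AS0 q10 q20 dt0 gs0 Mq0; rewrite tE gT /k; clear; lra.
have slt : s < T + 1.
  rewrite lt_neqAle sT andbT; apply/eqP => sE.
  by move: Phi2 v1C v2C AS0 q10 q20 dt0 gt0 Mq0; rewrite sE gT /k; clear; lra.
have xyd j : `|x 0 j - y 0 j| < d.
  by have := @coord_lt_sq _ _ (x - y) d j d0 (le_lt_trans sqxy he2); rewrite !mxE.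
(* If one time is 0, the initial estimate bounds the time increment by [A] times the other time,
   which the penalty absorbs; uniform continuity handles the change of position with the error
   [Mq]. *)
have tpos : 0 < t.
  rewrite lt_neqAle t0 andbT; apply/eqP => tE.
  have h1 : `|ext u i (s, x) - ext u i (0, x)| <= A * s by apply: hA; rewrite s0.
  have h2 : `|ext u i (s, x) - ext u i (s, y)| < Mq.
    by apply: hd; rewrite ?s0 ?subrr ?normr0.
  have h3 := ler_wpM2l A0 (sqrt_add_ge (0 - s) e).
  rewrite -/(S 0 s) sub0r normrN ger0_norm// in h3.
  move: h1 h2; rewrite ler_norml ltr_norml => /andP[h1 _] /andP[_ h2].
  by move: Phi2 q10 q20 dt0 gs0 gt0 h1 h2 h3 Mq0; rewrite -tE; clear; lra.
have spos : 0 < s.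
  rewrite lt_neqAle s0 andbT; apply/eqP => sE.
  have h1 : `|ext u i (t, y) - ext u i (0, y)| <= A * t by apply: hA; rewrite t0.
  have h2 : `|ext u i (t, x) - ext u i (t, y)| < Mq.
    by apply: hd; rewrite ?t0 ?subrr ?normr0.
  have h3 := ler_wpM2l A0 (sqrt_add_ge (t - 0) e).
  rewrite -/(S t 0) subr0 ger0_norm// in h3.
  move: h1 h2; rewrite ler_norml ltr_norml => /andP[_ h1] /andP[_ h2].
  by move: Phi2 q10 q20 dt0 gs0 gt0 h1 h2 h3 Mq0; rewrite -sE; clear; lra.
have xx1 j : `|x 0 j - x1 0 j| <= 2 * C / e + 1.
  have := @coord_le_sq _ _ (x - x1) (2 * C / e + 1) j; rewrite !mxE; apply.
    by rewrite addr_ge0.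
  apply: le_trans (le_sqr_add1 Cie0).
  by rewrite ler_pdivlMr// mulrC.
have yx j : `|x 0 j - y 0 j| <= 2 * C * e + 1.
  have := @coord_le_sq _ _ (x - y) (2 * C * e + 1) j; rewrite !mxE; apply.
    by rewrite addr_ge0.
  by apply: (le_trans sqxy); exact: le_sqr_add1.
have xlt j : `|x 0 j - x1 0 j| < rho.
  by have := xx1 j; rewrite /rho; move: Cee0; clear; lra.
have ylt j : `|y 0 j - x1 0 j| < rho.
  have -> : y 0 j - x1 0 j = (x 0 j - x1 0 j) - (x 0 j - y 0 j) by ring.
  have := ler_normB (x 0 j - x1 0 j) (x 0 j - y 0 j).
  by move: (xx1 j) (yx j); rewrite /rho; clear; lra.

(* Viscosity inequalities at the two points *)
pose gt : R := 2 * k * Num.max 0 (t - T).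
pose gs : R := 2 * k * Num.max 0 (s - T).
have max0 (a : R) : 0 <= Num.max 0 a by rewrite le_max lexx.
have gtp : 0 <= gt by rewrite /gt !mulr_ge0// ltW.
have gsp : 0 <= gs by rewrite /gs !mulr_ge0// ltW.
have gjet (a b : R) : g b <= g a + 2 * k * Num.max 0 (a - T) * (b - a)
    + k * (b - a) ^+ 2.
  have := pos_sqr_jet (a - T) (b - T).
  have -> : b - T - (a - T) = b - a by ring.
  by rewrite -(ler_pM2l k0) /g; clear; lra.
have Sjet (a b : R) : S a b <= S t s + ((a - b) ^+ 2 - (t - s) ^+ 2) / (2 * S t s).
  have := @sqrt_jet _ ((t - s) ^+ 2 + e ^+ 2) ((a - b) ^+ 2 + e ^+ 2).
  rewrite -sqrtr_gt0 -/(S t s) -/(S a b) S0 addr_ge0 ?sqr_ge0// => /(_ isT isT).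
  by have -> : (a - b) ^+ 2 + e ^+ 2 - ((t - s) ^+ 2 + e ^+ 2) =
    (a - b) ^+ 2 - (t - s) ^+ 2 by ring.
have S00 : S t s != 0 by rewrite gt_eqF.
have e00 : e != 0 by rewrite gt_eqF.
have iS0 : 0 <= A / (2 * S t s) by rewrite divr_ge0// mulr_ge0// ltW.
pose q : 'rV[R]_N := (2 / e) *: (x - y).
pose p : 'rV[R]_N := q + (2 * e) *: (x - x1).
have ie0 : 0 < e^-1 by rewrite invr_gt0.
have sub := @ext_sub_jet _ _ _ _ _ _ _ hu i t x
  (A * (t - s) / S t s + de + gt) p (A / (2 * S t s) + e^-1 + e + k) tpos.
have {}sub : A * (t - s) / S t s + de + gt + H i x p
    + \sum_j B i j * ext u j (t, x) <= 0.
  apply: sub; near=> z.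
  have zK : K (z, (s, y)).
    have : 0 <= z.1 <= T + 1 /\ box x1 rho z.2.
      by near: z; apply: near_cylinder => //; rewrite tpos.
    by case=> h1 h2; split => //=; split => //=; rewrite in_itv/= ?h1 ?s0.
  have := hmax i _ zK; rewrite /Phi /= => hz.
  have h1 := ler_wpM2l A0 (Sjet z.1 s).
  have h2 := gjet t z.1; rewrite -/gt in h2.
  have h3 := sq_shift x y z.2; have h4 := sq_shift x x1 z.2.
  rewrite h3 h4 in hz.
  rewrite /quad_test /p /q dotDl !dotZl.
  have h5 : A * (S t s + ((z.1 - s) ^+ 2 - (t - s) ^+ 2) / (2 * S t s)) =
    A * S t s + A * (t - s) / S t s * (z.1 - t) + A / (2 * S t s) * (z.1 - t) ^+ 2.
    by field.
  rewrite h5 in h1.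
  have k1 : 0 <= (A / (2 * S t s) + k) * sq (z.2 - x).
    by rewrite mulr_ge0 ?sq_ge0// addr_ge0// ltW.
  have k2 : 0 <= (e^-1 + e) * (z.1 - t) ^+ 2.
    by rewrite mulr_ge0 ?sqr_ge0// addr_ge0 ?ltW.
  move: hz h1 h2 k1 k2; clear.
  move: (A / (2 * S t s)) (A * (t - s) / S t s) (S t s) (S z.1 s) => a b c c'.
  by lra.
have sup := @ext_super_jet _ _ _ _ _ _ _ hu i s y
  (A * (t - s) / S t s - gs) q (- (A / (2 * S t s) + e^-1 + k)) spos.
have {}sup : 0 <= A * (t - s) / S t s - gs + H i y q
    + \sum_j B i j * ext u j (s, y).
  apply: sup; near=> z.
  have zK : K ((t, x), z).
    have : 0 <= z.1 <= T + 1 /\ box x1 rho z.2.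
      by near: z; apply: near_cylinder => //; rewrite spos.
    by case=> h1 h2; split => //=; split => //=; rewrite in_itv/= ?h1 ?t0.
  have := hmax i _ zK; rewrite /Phi /= => hz.
  have h1 := ler_wpM2l A0 (Sjet t z.1).
  have h2 := gjet s z.1; rewrite -/gs in h2.
  have h3 : sq (x - z.2) = sq (x - y) - 2 * dot (x - y) (z.2 - y) + sq (z.2 - y).
    rewrite -sqB; congr sq; apply/rowP => j; rewrite !mxE; ring.
  rewrite h3 in hz.
  rewrite /quad_test /q dotZl.
  have h5 : A * (S t s + ((t - z.1) ^+ 2 - (t - s) ^+ 2) / (2 * S t s)) =
    A * S t s - A * (t - s) / S t s * (z.1 - s) + A / (2 * S t s) * (z.1 - s) ^+ 2.
    by field.
  rewrite h5 in h1.
  have k1 : 0 <= (A / (2 * S t s) + k) * sq (z.2 - y).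
    by rewrite mulr_ge0 ?sq_ge0// addr_ge0// ltW.
  have k2 : 0 <= e^-1 * (z.1 - s) ^+ 2 by rewrite mulr_ge0 ?sqr_ge0// ltW.
  move: hz h1 h2 k1 k2; clear.
  move: (A / (2 * S t s)) (A * (t - s) / S t s) (S t s) (S t z.1) => a b c c'.
  by lra.
(* The penalties cancel when [Phi j] and [Phi i] are compared at the same point. *)
have cpl : 0 <= \sum_j B i j * (ext u j (t, x) - ext u j (s, y)).
  apply: coupling_max => // j.
  have := hmax j ((t, x), (s, y)).
  have hK : K ((t, x), (s, y)).
    by split; split => //=; rewrite in_itv/= ?t0 ?s0.
  by move=> /(_ hK); rewrite /Phi /=; clear; lra.
have {}cpl : \sum_j B i j * ext u j (s, y) <= \sum_j B i j * ext u j (t, x).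
  rewrite -subr_ge0 -sumrB; apply: le_trans cpl _.
  by apply: ler_sum => j _; rewrite mulrBr.
(* Both jets share this time slope. Bounded below, it bounds [H i x p] from above in the subsolution
   inequality, whence [hp] by coercivity. *)
have bnd : - A <= A * (t - s) / S t s.
  have := sqrt_add_ge (t - s) e; rewrite -/(S t s) => h.
  rewrite ler_pdivlMr// mulNr -mulrN ler_wpM2l//.
  by rewrite lerNl (le_trans _ h)// -normrN ler_norm.
have hCb1 : `|\sum_j B i j * ext u j (t, x)| <= Cb by apply: hCb; rewrite t0.
have hp : sq p <= R0 ^+ 2.
  apply: (hR0 i x); move: hCb1; rewrite ler_norml => /andP[+ _].
  by move: sub bnd gtp de0; clear; lra.
have sqpq : sq (p - q) <= 8 * C * e.
  have -> : p - q = (2 * e) *: (x - x1) by rewrite /p addrAC subrr add0r.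
  rewrite sqZ; have : 4 * e * (e * sq (x - x1)) <= 4 * e * (2 * C).
    by rewrite ler_pM2l// mulr_gt0.
  by clear; lra.
have hq : sq q < r ^+ 2.
  have -> : q = p + (-1) *: (p - q) by apply/rowP => j; rewrite !mxE; ring.
  have := sq_ge0 (p - (-1) *: (p - q)); rewrite sqB sqD sqZ /r.
  by move: hp sqpq he3 R00; clear; nra.
have pr : sq p < r ^+ 2 by rewrite /r; move: hp R00; clear; nra.
have xyd' j : `|x 0 j - y 0 j| < d'.
  have := @coord_lt_sq _ _ (x - y) d' j d'0; rewrite !mxE; apply.
  by apply: (le_lt_trans sqxy); move: he4 Cee0; clear; lra.
have pqd' j : `|p 0 j - q 0 j| < d'.
  have := @coord_lt_sq _ _ (p - q) d' j d'0; rewrite !mxE; apply.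
  exact: (le_lt_trans sqpq).
(* Subtracting the two inequalities makes [H i y q - H i x p] at least [de], against uniform
   continuity. *)
have := hd' i x y p q pr hq xyd' pqd'; rewrite ltr_norml => /andP[+ _].
by move: sub sup cpl gtp gsp de0; clear; lra.
Unshelve. all: by end_near.
Qed.

(** * Semiconcavity *)

(** Cauchy-Schwarz, from the nonnegativity of [sq (sq y *: x - dot x y *: y)]. *)
Lemma dot_sq_le (R : realType) n (x y : 'rV[R]_n) : dot x y ^+ 2 <= sq x * sq y.
Proof.
have [y0|y0] := eqVneq (sq y) 0.
  have -> : dot x y = 0.
    rewrite /dot big1// => j _; suff -> : y 0 j = 0 by rewrite mulr0.
    apply/eqP; rewrite -normr_le0; apply: coord_le_sq => //.
    by rewrite y0 expr0n.
  by rewrite expr0n/= mulr_ge0 ?sq_ge0.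
have yp : 0 < sq y by rewrite lt_neqAle eq_sym y0 sq_ge0.
have := sq_ge0 (sq y *: x - dot x y *: y).
rewrite sqB !sqZ dotZl dotZr.
have -> : sq y ^+ 2 * sq x - 2 * (sq y * (dot x y * dot x y)) +
  dot x y ^+ 2 * sq y = sq y * (sq x * sq y - dot x y ^+ 2) by ring.
by rewrite pmulr_rge0// subr_ge0.
Qed.

(** Every penalty increment is expanded and divided by [l], which leaves [l] only in the factor
    [1 - l] of the second gradient. Exchanging [l] with [1 - l] and [x] with [z] gives the jet at
    the other end of the segment. *)
Lemma touch_upper (R : realType) (n : nat) (v : R * 'rV[R]_n -> R)
    (l G e t r : R) (x y z : 'rV[R]_n) :
  0 < l <= 1 -> 0 < G -> 0 < e ->
  (\forall w \near (t, x),
     l * v w - l * (1 - l) * G * sq (w.2 - z)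
       - e^-1 * (sq (l *: w.2 + (1 - l) *: z - y) + l * (w.1 - r) ^+ 2) <=
     l * v (t, x) - l * (1 - l) * G * sq (x - z)
       - e^-1 * (sq (l *: x + (1 - l) *: z - y) + l * (t - r) ^+ 2)) ->
  \forall w \near (t, x), v w <= v (t, x) +
    quad_test t x (2 / e * (t - r)) (G + e^-1)
      ((2 / e) *: (l *: x + (1 - l) *: z - y) + (2 * G * (1 - l)) *: (x - z)) w.
Proof.
move=> /andP[l0 l1] G0 e0; apply: filterS => w.
have ie0 : 0 < e^-1 by rewrite invr_gt0.
have -> : l *: w.2 + (1 - l) *: z - y =
    (l *: x + (1 - l) *: z - y) + l *: (w.2 - x).
  by apply/rowP => j; rewrite !mxE; ring.
have -> : w.2 - z = (x - z) + (w.2 - x) by apply/rowP => j; rewrite !mxE; ring.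
rewrite (sqD _ (l *: (w.2 - x))) (sqD _ (w.2 - x)) sqZ dotZr.
rewrite /quad_test (dotDl ((2 / e) *: _)) !dotZl.
set d2 := dot (x - z) _; set d1 := dot _ (w.2 - x).
have -> : w.1 - r = (t - r) + (w.1 - t) by ring.
move: (sq (w.2 - x)) (sq_ge0 (w.2 - x)) (w.1 - t) => s s0 k h.
rewrite -(ler_pM2l l0) -subr_ge0.
have k1 : 0 <= G * k ^+ 2 by rewrite mulr_ge0 ?sqr_ge0 ?ltW.
have k2 : 0 <= l * (G * s) by rewrite !mulr_ge0// ltW.
have k3 : 0 <= (1 - l) * (e^-1 * s) by rewrite !mulr_ge0 ?subr_ge0// ltW.
have k4 : 0 <= l * (l * (G * s) + (1 - l) * (e^-1 * s) + G * k ^+ 2).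
  apply: mulr_ge0; first exact: ltW.
  by apply: addr_ge0 => //; apply: addr_ge0 => //; rewrite mulr_ge0// ltW.
move: h k4; clear; move: (e^-1) (sq _) (sq _) (v w) (v _) => *; lra.
Qed.

(** The extra terms of the slope and of the gradient are the derivatives of the weight [X / rho].
    Its second-order remainder is controlled because [rho] stays above [sg] near the point. *)
Lemma touch_lower (R : realType) (n : nat) (v : R * 'rV[R]_n -> R)
    (l X sg b t0 e t s r : R) (x0 c y : 'rV[R]_n) :
  0 <= l <= 1 -> 0 <= X -> 0 < e -> 0 < sg -> b <= 1 ->
  let rho (w : R * 'rV[R]_n) := b - (w.1 - t0) ^+ 2 - sq (w.2 - x0) in
  0 < rho (r, y) ->
  (\forall w \near (r, y), sg <= rho w /\
     - v w - X / rho w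
       - e^-1 * (sq (c - w.2) + l * (t - w.1) ^+ 2 + (1 - l) * (s - w.1) ^+ 2) <=
     - v (r, y) - X / rho (r, y)
       - e^-1 * (sq (c - y) + l * (t - r) ^+ 2 + (1 - l) * (s - r) ^+ 2)) ->
  \forall w \near (r, y), v (r, y) +
    quad_test r y (2 / e * (l * (t - r) + (1 - l) * (s - r))
        - 2 * X / rho (r, y) ^+ 2 * (r - t0))
      (- (X / rho (r, y) ^+ 2 * (1 + 15 / sg) + e^-1))
      ((2 / e) *: (c - y) - (2 * X / rho (r, y) ^+ 2) *: (y - x0)) w <= v w.
Proof.
move=> /andP[l0 l1] X0 e0 sg0 b1 rho rp h.
have near1 : \forall w \near (r, y), (w.1 - r) ^+ 2 + sq (w.2 - y) < 1.
  apply: (@near_lt _ _ (fun w : R * 'rV[R]_n => (w.1 - r) ^+ 2 + sq (w.2 - y))).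
    apply: contD.
      by apply: contX2; apply: contB; [exact: cont_fst|exact: cont_cst].
    by apply: continuous_sq; apply: contBv; [exact: cont_snd|exact: cont_cst].
  by rewrite /= !subrr sq0 expr0n addr0.
apply: filterS2 h near1 => w [sgw hw] w1.
have ie0 : 0 < e^-1 by rewrite invr_gt0.
have rw0 : 0 < rho w by exact: lt_le_trans sgw.
pose k : R := w.1 - r; pose S : R := sq (w.2 - y).
pose dd : R := dot (y - x0) (w.2 - y).
pose Q : R := 2 * (r - t0) * k + k ^+ 2 + 2 * dd + S.
have S0 : 0 <= S by exact: sq_ge0.
have eQ : rho (r, y) - rho w = Q.
  rewrite /rho /= (_ : w.2 - x0 = (y - x0) + (w.2 - y)); last first.
    by apply/rowP => j; rewrite !mxE; ring.
  by rewrite (sqD _ (w.2 - y)) /Q /dd /S /k; clear; move: (dot _ _) (sq _) (sq _) => *; ring.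
have rt1 : (r - t0) ^+ 2 <= 1.
  by move: rp b1 (sq_ge0 (y - x0)); rewrite /rho /=; clear; lra.
have yx1 : sq (y - x0) <= 1.
  by move: rp b1 (sqr_ge0 (r - t0)); rewrite /rho /=; clear; lra.
have dd1 : dd ^+ 2 <= S.
  apply: (le_trans (dot_sq_le _ _)).
  by apply: ler_piMl => //; exact: sq_ge0.
(* A sum of three terms has square at most three times the sum of their squares, here [4 * k ^+ 2],
   [4 * S] and [k ^+ 2 + S] at most. *)
have Q2 : Q ^+ 2 <= 15 * (k ^+ 2 + S).
  have kS : (k ^+ 2 + S) ^+ 2 <= k ^+ 2 + S.
    rewrite expr2 ler_piMr ?addr_ge0 ?sqr_ge0//; exact: ltW.
  have rk : ((r - t0) * k) ^+ 2 <= k ^+ 2.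
    by rewrite exprMn ler_piMl ?sqr_ge0.
  have -> : Q = 2 * ((r - t0) * k) + 2 * dd + (k ^+ 2 + S) by rewrite /Q; ring.
  move: kS rk dd1; move: ((r - t0) * k) => a kS rk dd1.
  have := sqr_ge0 (2 * a - 2 * dd).
  have := sqr_ge0 (2 * a - (k ^+ 2 + S)).
  have := sqr_ge0 (2 * dd - (k ^+ 2 + S)).
  move: kS rk dd1; clear; move: (k ^+ 2) => kk; nra.
have inv : (rho w)^-1 <= (rho (r, y))^-1 + Q / rho (r, y) ^+ 2
    + 15 * (k ^+ 2 + S) / (rho (r, y) ^+ 2 * sg).
  have eqn : (rho w)^-1 = (rho (r, y))^-1 + Q / rho (r, y) ^+ 2
      + Q ^+ 2 / (rho (r, y) ^+ 2 * rho w).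
    by rewrite -eQ; field; rewrite !gt_eqF.
  rewrite eqn lerD2l; apply: ler_pM => //; first exact: sqr_ge0.
    by rewrite invr_ge0 mulr_ge0 ?sqr_ge0 ?ltW.
  by rewrite lef_pV2 ?posrE ?mulr_gt0 ?exprn_gt0// ler_pM2l ?exprn_gt0.
have {}inv := ler_wpM2l X0 inv.
have ec : sq (c - w.2) = sq (c - y) - 2 * dot (c - y) (w.2 - y) + S.
  by rewrite -sqB; congr sq; apply/rowP => j; rewrite !mxE; ring.
rewrite ec in hw.
rewrite /quad_test (dotDl ((2 / e) *: _)) dotNl !dotZl -/k -/S -/dd.
have ek : w.1 = r + k by rewrite /k; ring.
rewrite ek in hw.
have e15 : X * ((rho (r, y))^-1 + Q / rho (r, y) ^+ 2
    + 15 * (k ^+ 2 + S) / (rho (r, y) ^+ 2 * sg)) =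
  X / rho (r, y) + 2 * X / rho (r, y) ^+ 2 * (r - t0) * k
  + 2 * X / rho (r, y) ^+ 2 * dd
  + X / rho (r, y) ^+ 2 * (1 + 15 / sg) * (S + k ^+ 2).
  by rewrite /Q; field; rewrite !gt_eqF.
rewrite e15 in inv.
move: hw inv; clear; move: (X / rho w) (X / rho (r, y)) => a1 a2.
move: (X / rho (r, y) ^+ 2 * (1 + 15 / sg)) (2 * X / rho (r, y) ^+ 2) => a3 a4.
move: (dot _ _) (sq _) (v w) (v _) (e^-1) => a5 a6 a7 a8 a9 h1 h2; lra.
Qed.

(** Compares [v] and the paraboloid a short time after [t]. A lower bound on [a] is what a
    subsolution needs for its Hamiltonian to be bounded from above. *)
Lemma slope_ge (R : realType) (n : nat) (v : R * 'rV[R]_n -> R)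
    (A t a M : R) (x p : 'rV[R]_n) :
  (\forall s \near t, v (t, x) - v (s, x) <= A * `|t - s|) ->
  (\forall z \near (t, x), v z <= v (t, x) + quad_test t x a M p z) ->
  - A <= a.
Proof.
move=> hA hv; rewrite leNgt; apply/negP => aA.
have hv' : \forall s \near t, v (s, x) <= v (t, x) + quad_test t x a M p (s, x).
  have c : (fun s : R => (s, x)) @ t --> (t, x).
    have h1 : (fun s : R => s) @ t --> t by exact: cvg_id.
    have h2 : (fun=> x) @ t --> x by exact: cvg_cst.
    exact: (cvg_pair h1 h2).
  exact: c hv.
have [d /= d0 hd] : nbhs_ball t ([set s | v (t, x) - v (s, x) <= A * `|t - s|]
    `&` [set s | v (s, x) <= v (t, x) + quad_test t x a M p (s, x)]).
  by apply/nbhs_ballP; exact: filterI.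
(* Short enough for the quadratic term to be smaller than the gap [- A - a] times [k]. *)
pose k : R := Num.min (d / 2) ((- A - a) / (2 * (`|M| + 1))).
have M1 : 0 < `|M| + 1 by rewrite ltr_wpDl.
have k0 : 0 < k.
  by rewrite lt_min; apply/andP; split; apply: divr_gt0 => //; move: aA M1; clear; lra.
have kd : k < d.
  by apply: (@le_lt_trans _ _ (d / 2)); [rewrite ge_min lexx|move: d0; clear; lra].
have kM : M * k < - A - a.
  apply: (@le_lt_trans _ _ ((`|M| + 1) * k)).
    by rewrite ler_wpM2r ?(ltW k0)// (le_trans (ler_norm M))// lerDl.
  apply: (@le_lt_trans _ _ ((`|M| + 1) * ((- A - a) / (2 * (`|M| + 1))))).
    by rewrite ler_wpM2l ?(ltW M1)// ge_min lexx orbT.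
  have -> : (`|M| + 1) * ((- A - a) / (2 * (`|M| + 1))) = (- A - a) / 2.
    by field; rewrite gt_eqF.
  by move: aA; clear; lra.
have tk : `|t - (t + k)| = k by rewrite opprD addrA subrr sub0r normrN gtr0_norm.
have /hd [/= + +] : ball t d (t + k) by rewrite -ball_normE /= tk.
rewrite tk.
rewrite /quad_test /= subrr sq0 (_ : dot p 0 = 0); last first.
  by rewrite /dot big1// => j _; rewrite mxE mulr0.
move=> h1 h2; suff : k * (M * k) >= k * (- A - a) by rewrite ler_pM2l// leNgt kM.
move: h1 h2; clear; lra.
Qed.

(* Both estimates weaken as [ka] decreases, so that one constant serves a finite
   family of functions. *)
Definition convex_lipschitz_on_box (R : realType) (N : nat) (ka s : R) (x0 : 'rV[R]_N)
    (F : 'rV[R]_N -> 'rV[R]_N -> R) : Prop :=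
  (forall (x z p q : 'rV[R]_N) (l : R), 0 <= l <= 1 ->
    box x0 3 x -> box x0 3 z -> box 0 s p -> box 0 s q ->
    l * (1 - l) * (ka * sq (p - q) - ka^-1 * sq (x - z)) <=
    l * F x p + (1 - l) * F z q
      - F (l *: x + (1 - l) *: z) (l *: p + (1 - l) *: q)) /\
  (forall x y p q, box x0 3 x -> box x0 3 y -> box 0 s p -> box 0 s q ->
    `|F x p - F y q| <= ka^-1 * \sum_j (`|x 0 j - y 0 j| + `|p 0 j - q 0 j|)).

Lemma ham_local (R : realType) (N m : nat)
    (H : 'I_m -> 'rV[R]_N -> 'rV[R]_N -> R) (x0 : 'rV[R]_N) (s : R) :
  (0 < N)%N -> 0 <= s ->
  (forall i : 'I_m,
      class_C 2 setT (fun z : 'rV[R]_N * 'rV[R]_N => H i z.1 z.2)) ->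
  (forall (i : 'I_m) (x p : 'rV[R]_N), posdef (hessian (H i x) p)) ->
  exists2 ka : R, 0 < ka & forall i, convex_lipschitz_on_box ka s x0 (H i).
Proof.
move=> N0 s0 hH2 hHpp; apply: uniform_pos => [i|i a b b0 ba [h1 h2]].
  have [L L0 hL] := local_lipschitz (hH2 i) x0 0 3 s.
  have [th th0 [C C0 hC]] := @local_strong_convexity _ _ _ (hH2 i) N0
    (fun x p => hHpp i x p) x0 0 3 s (ler0n _ 3) s0.
  pose ka : R := Num.min th (Num.min L^-1 C^-1).
  have ka0 : 0 < ka by rewrite !lt_min th0 !invr_gt0 L0.
  have kath : ka <= th by rewrite ge_min lexx.
  have kaL : L <= ka^-1.
    rewrite -[L]invrK lef_pV2 ?posrE ?invr_gt0//.
    by rewrite ge_min ge_min lexx orbT.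
  have kaC : C <= ka^-1.
    rewrite -[C]invrK lef_pV2 ?posrE ?invr_gt0//.
    by rewrite ge_min ge_min lexx !orbT.
  exists ka => //; split=> [x z p q l l01 hx hz hp hq|x y p q hx hy hp hq].
    apply: le_trans (hC x z p q l l01 hx hz hp hq).
    case/andP: l01 => l0 l1.
    rewrite ler_wpM2l ?mulr_ge0 ?subr_ge0// lerB//.
      by rewrite ler_wpM2r// sq_ge0.
    by rewrite ler_wpM2r// sq_ge0.
  apply: (le_trans (hL x y p q hx hy hp hq)).
  by rewrite ler_wpM2r// sumr_ge0// => j _; rewrite addr_ge0.
have ab : a^-1 <= b^-1 by rewrite lef_pV2 ?posrE// (lt_le_trans b0).
split=> [x z p q l l01 hx hz hp hq|x y p q hx hy hp hq].
  apply: le_trans (h1 x z p q l l01 hx hz hp hq).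
  case/andP: l01 => l0 l1.
  rewrite ler_wpM2l ?mulr_ge0 ?subr_ge0// lerB//.
    by rewrite ler_wpM2r// sq_ge0.
  by rewrite ler_wpM2r// sq_ge0.
apply: (le_trans (h2 x y p q hx hy hp hq)).
by rewrite ler_wpM2r// sumr_ge0// => j _; rewrite addr_ge0.
Qed.

Lemma box_sq (R : realType) n (p : 'rV[R]_n) (r : R) :
  0 <= r -> sq p <= r ^+ 2 -> box 0 r p.
Proof. by move=> r0 pr j; rewrite [X in _ - X]mxE subr0; exact: coord_le_sq. Qed.

(* The time slope [tau] and the correction of [p] in the last argument come
   from differentiating the weight [K / rho]; both are of size [K / rho ^ 2]
   and lose against the convexity gain, of size [K ^ 2 / rho ^ 2]. *)
Lemma semiconcavity_gain (R : realType) (N : nat)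
    (F : 'rV[R]_N -> 'rV[R]_N -> R) (ka r K rho l e tau : R)
    (x0 x y z p : 'rV[R]_N) :
  0 < ka -> convex_lipschitz_on_box ka (r + 1) x0 F -> 0 < r -> 1 <= K -> r <= K ->
  2 * r ^+ 2 <= K -> ka^-1 + 3 + 2 * N%:R * ka^-1 <= 4 * ka * K ->
  0 < rho <= 1 -> 0 < l < 1 -> 0 < e -> e * r <= 1 -> sq (y - x0) <= 1 ->
  `|tau| <= 1 ->
  let G := K / rho in let X := l * (1 - l) * sq (x - z) in
  p = (2 / e) *: (l *: x + (1 - l) *: z - y) ->
  let px := p + (2 * G * (1 - l)) *: (x - z) in
  let pz := p + (2 * G * l) *: (z - x) in
  let py := p - (2 * (X * K) / rho ^+ 2) *: (y - x0) in
  sq px <= r ^+ 2 -> sq pz <= r ^+ 2 ->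
  l * F x px + (1 - l) * F z pz - F y py <= 2 * (X * K) / rho ^+ 2 * tau ->
  X <= ka^-1 * N%:R * r * e.
Proof.
move=> ka0 [hcv hlip] r0 K1 rK r2K hK /andP[rho0 rho1] /andP[l0 l1] e0 er1 yx1.
move=> tau1 G X pE px pz py hpx hpz main.
have K0 : 0 < K by exact: lt_le_trans K1.
have G0 : 0 < G by rewrite divr_gt0.
have l01 : 0 <= l <= 1 by rewrite !ltW.
have l1' : 0 < 1 - l by rewrite subr_gt0.
have ll0 : 0 < l * (1 - l) by rewrite mulr_gt0.
have ll1 : l * (1 - l) <= 1 by rewrite mulr_ile1 ?ltW//; move: l0; clear; lra.
have X0 : 0 <= X by rewrite mulr_ge0 ?sq_ge0 ?ltW.
have dpE : px - pz = (2 * G) *: (x - z).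
  by rewrite /px /pz; apply/rowP => j; rewrite !mxE; ring.
have pcE : l *: px + (1 - l) *: pz = p.
  by rewrite /px /pz; apply/rowP => j; rewrite !mxE; ring.
(* Two gradients of length at most [r] differ by [2 * G] times [x - z], so bounded gradients force
   [x] and [z] together. *)
have sqd : sq (x - z) <= (r * rho / K) ^+ 2.
  have h1 : sq (px - pz) <= 4 * r ^+ 2.
    have := sq_ge0 (px + pz); rewrite sqB sqD; move: hpx hpz; clear; lra.
  rewrite dpE sqZ in h1.
  have -> : (r * rho / K) ^+ 2 = (4 * r ^+ 2) / (2 * G) ^+ 2.
    by rewrite /G; field; rewrite !gt_eqF.
  have G2 : 0 < (2 * G) ^+ 2 by rewrite exprn_gt0// mulr_gt0.
  by rewrite ler_pdivlMr// mulrC.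
have rK1 : r * rho / K <= 1.
  rewrite ler_pdivrMr// mul1r; apply: le_trans rK.
  by rewrite ler_piMr// ltW.
have rK0 : 0 <= r * rho / K by rewrite divr_ge0 ?mulr_ge0 ?ltW.
have dj j : `|x 0 j - z 0 j| <= 1.
  have := coord_le_sq j rK0 sqd; rewrite !mxE => /le_trans; apply; exact: rK1.
have yj j : `|y 0 j - x0 0 j| <= 1.
  have := @coord_le_sq _ _ (y - x0) 1 j ler01; rewrite expr1n !mxE; exact.
have r1 : r <= r + 1 by rewrite lerDl.
have r1' : 0 <= r + 1 by rewrite addr_ge0// ltW.
have bpx0 : box 0 r px by apply: box_sq => //; exact: ltW.
have bpz0 : box 0 r pz by apply: box_sq => //; exact: ltW.
have bp0 : box 0 r p by rewrite -pcE; exact: box_convex.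
have bw (w : 'rV[R]_N) : box 0 r w -> box 0 (r + 1) w.
  by move=> h j; exact: le_trans (h j) r1.
set c := l *: x + (1 - l) *: z in pE *.
(* As [p] is bounded, the barycentre [c] is within order [e] of [y]; this is the only error left at
   the end. *)
have cyE : c - y = (e / 2) *: p.
  by rewrite pE scalerA (_ : _ * _ = 1) ?scale1r//; field; rewrite gt_eqF.
have cyj j : `|c 0 j - y 0 j| <= e * r / 2.
  have : c 0 j - y 0 j = e / 2 * p 0 j.
    by have /rowP/(_ j) := cyE; rewrite !mxE.
  move=> ->; rewrite normrM gtr0_norm ?divr_gt0// mulrAC ler_pM2r ?invr_gt0//.
  by rewrite ler_pM2l//; have := bp0 j; rewrite mxE subr0.
have cyj1 j : `|c 0 j - y 0 j| <= 1.
  by apply: (le_trans (cyj j)); move: er1; clear; lra.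
have by0 : box x0 3 y by move=> j; apply: (le_trans (yj j)); clear; lra.
(* The radius 3 adds up three unit bounds, for [c - y], [x - z] and [y - x0]. *)
have bx : box x0 3 x.
  move=> j; have -> : x 0 j - x0 0 j = (c 0 j - y 0 j) + (1 - l) * (x 0 j - z 0 j)
    + (y 0 j - x0 0 j) by rewrite /c !mxE; ring.
  apply: (le_trans (ler_normD _ _)).
  have -> : (3 : R) = 2 + 1 by clear; lra.
  apply: lerD (yj j); apply: (le_trans (ler_normD _ _)).
  apply: lerD; first exact: cyj1.
  by rewrite normrM gtr0_norm// mulr_ile1 ?(ltW l1') ?lerBlDr ?lerDl ?(ltW l0).
have bz : box x0 3 z.
  move=> j; have -> : z 0 j - x0 0 j = (c 0 j - y 0 j) + - (l * (x 0 j - z 0 j))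
    + (y 0 j - x0 0 j) by rewrite /c !mxE; ring.
  apply: (le_trans (ler_normD _ _)).
  have -> : (3 : R) = 2 + 1 by clear; lra.
  apply: lerD (yj j); apply: (le_trans (ler_normD _ _)).
  apply: lerD; first exact: cyj1.
  by rewrite normrN normrM gtr0_norm// mulr_ile1 ?(ltW l0) ?(ltW l1).
have bc : box x0 3 c by exact: box_convex.
have XK0 : 0 <= 2 * (X * K) / rho ^+ 2.
  apply: divr_ge0; last exact: sqr_ge0.
  by apply: mulr_ge0 => //; apply: mulr_ge0 => //; exact: ltW.
(* Keeps [py] within distance 1 of [p] in every coordinate, hence in the box of radius [r + 1]. *)
have XK1 : 2 * (X * K) / rho ^+ 2 <= 1.
  rewrite ler_pdivrMr ?exprn_gt0// mul1r.
  have hX : X <= (r * rho / K) ^+ 2.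
    apply: le_trans sqd; rewrite ler_piMl ?sq_ge0//.
  apply: (@le_trans _ _ (2 * ((r * rho / K) ^+ 2 * K))).
    by rewrite ler_pM2l// ler_pM2r.
  have -> : 2 * ((r * rho / K) ^+ 2 * K) = rho ^+ 2 * (2 * r ^+ 2 / K).
    by field; rewrite gt_eqF.
  by rewrite ler_piMr ?sqr_ge0// ler_pdivrMr// mul1r.
have pyj j : `|p 0 j - py 0 j| <= 2 * (X * K) / rho ^+ 2.
  have -> : p 0 j - py 0 j = 2 * (X * K) / rho ^+ 2 * (y 0 j - x0 0 j).
    by rewrite /py !mxE; ring.
  by rewrite normrM ger0_norm// ler_piMr.
have bpy : box 0 (r + 1) py.
  move=> j; rewrite [X in _ - X]mxE subr0.
  have -> : py 0 j = p 0 j - (p 0 j - py 0 j) by ring.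
  apply: (le_trans (ler_normB _ _)); apply: lerD.
    by have := bp0 j; rewrite mxE subr0.
  exact: le_trans (pyj j) XK1.
have h1 := hcv x z px pz l l01 bx bz (bw _ bpx0) (bw _ bpz0).
rewrite -/c pcE dpE sqZ in h1.
have h2 := hlip c y p py bc by0 (bw _ bp0) bpy.
have h3 : \sum_j (`|c 0 j - y 0 j| + `|p 0 j - py 0 j|) <=
    N%:R * (e * r / 2 + 2 * (X * K) / rho ^+ 2).
  rewrite mulr_natl -[N in leRHS]card_ord -sumr_const; apply: ler_sum => j _.
  by apply: lerD.
have ik0 : 0 < ka^-1 by rewrite invr_gt0.
have {h2}h3 : `|F c p - F y py| <= ka^-1 * (N%:R * (e * r / 2 + 2 * (X * K) / rho ^+ 2)).
  by apply: (le_trans h2); rewrite ler_pM2l.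
move: h3; rewrite ler_norml => /andP[h3 _].
have h4 : 2 * (X * K) / rho ^+ 2 * tau <= 2 * (X * K) / rho ^+ 2.
  by rewrite ler_piMr// (le_trans (ler_norm _)).
have h5 : X * (ka * (2 * G) ^+ 2 - ka^-1) <= 2 * (X * K) / rho ^+ 2 +
    ka^-1 * (N%:R * (e * r / 2 + 2 * (X * K) / rho ^+ 2)).
  move: h1 h3 h4 main; rewrite /X; clear.
  move: (2 * _ / rho ^+ 2) (F x px) (F z pz) (F y py) (F c p) (_ ^+ 2) => *; lra.
(* Multiplied by [K], the hypothesis [hK] pays for every error. Of its [3 * K], two parts pay for
   the time derivative of the weight and the third leaves at least [rho ^+ 2], so the bracket is at
   least 1. *)
have h6 : X <= X * ((4 * ka * K ^+ 2 - ka^-1 * rho ^+ 2 - 2 * K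
    - 2 * K * (ka^-1 * N%:R)) / rho ^+ 2).
  apply: ler_peMr => //; rewrite ler_pdivlMr ?exprn_gt0// mul1r.
  have rr : rho ^+ 2 <= 1 by rewrite expr_le1// ltW.
  have := ler_wpM2r (ltW K0) hK.
  have m1 : 0 <= ka^-1 * (K - rho ^+ 2).
    by rewrite mulr_ge0 ?(ltW ik0)// subr_ge0 (le_trans rr).
  move: m1 rr K1; clear; move: (rho ^+ 2) => *; lra.
have h7 : X * ((4 * ka * K ^+ 2 - ka^-1 * rho ^+ 2 - 2 * K
    - 2 * K * (ka^-1 * N%:R)) / rho ^+ 2) =
  X * (ka * (2 * G) ^+ 2 - ka^-1) - 2 * (X * K) / rho ^+ 2
  - ka^-1 * (N%:R * (2 * (X * K) / rho ^+ 2)).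
  by rewrite /G; field; rewrite !gt_eqF.
have h8 : 0 <= ka^-1 * N%:R * r * e by rewrite !mulr_ge0 ?(ltW ik0) ?(ltW r0) ?(ltW e0).
apply: (le_trans h6); rewrite h7.
move: h5 h8; clear; move: (2 * (X * K) / rho ^+ 2) ((2 * G) ^+ 2) => *; lra.
Qed.

Lemma contV (R : realType) (T : topologicalType) (f : T -> R) :
  (forall x, f x != 0) -> continuous f -> continuous (fun x => (f x)^-1).
Proof. by move=> f0 cf x; apply: cvgV; [exact: f0|exact: cf]. Qed.

Lemma ltr_norm_sqr (R : realType) (a b : R) : 0 < b -> a ^+ 2 < b ^+ 2 -> `|a| < b.
Proof.
move=> b0; rewrite -(real_normK (num_real a)) ltr_sqr ?nnegrE//; exact: ltW.
Qed.

(** Only the barycentre is localised. The bound degenerates at the edge of the ball, which is what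
    keeps the maximum of the argument inside; a uniform constant follows on a smaller ball. *)
Lemma semiconcave_weighted (R : realType) (N m : nat)
    (H : 'I_m -> 'rV[R]_N -> 'rV[R]_N -> R) (B : 'M[R]_m)
    (u0 : 'rV[R]_N -> 'cV[R]_m) (u : R * 'rV[R]_N -> 'cV[R]_m)
    (t0 : R) (x0 : 'rV[R]_N) :
  (0 < N)%N ->
  standing_hamiltonians H -> coupling_matrix B ->
  (forall i : 'I_m,
      class_C 2 setT (fun z : 'rV[R]_N * 'rV[R]_N => H i z.1 z.2)) ->
  (forall (i : 'I_m) (x p : 'rV[R]_N), posdef (hessian (H i x) p)) ->
  lipschitz u0 -> is_cauchy_solution H B u0 u -> 0 < t0 ->
  exists b K : R, [/\ 0 < b, 0 < K & forall i (x z : 'rV[R]_N) (l : R),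
    0 < l < 1 -> let y := l *: x + (1 - l) *: z in sq (y - x0) < b ^+ 2 ->
    l * ext u i (t0, x) + (1 - l) * ext u i (t0, z) - ext u i (t0, y) <=
      l * (1 - l) * sq (x - z) * K / (b ^+ 2 - sq (y - x0))].
Proof.
move=> N0 hH hB hH2 hHpp hu0l hu t00.
have T0 : 0 < 2 * t0 by rewrite mulr_gt0.
have [C C1 hC] := sol_bounded hu T0.
have [Cb Cb0 hCb] := coupling_bounded hu T0.
have [A A0 hA] := time_lipschitz hH hB hu0l hu T0.
have [r r0 hr] := ham_coercive hH (Cb + A).
have r10 : 0 <= r + 1 by rewrite addr_ge0// ltW.
have [ka ka0 hka] := ham_local x0 N0 r10 hH2 hHpp.
(* The sum of the four lower bounds that [semiconcavity_gain] asks of [K]. *)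
pose K : R := 1 + r + 2 * r ^+ 2 + (ka^-1 + 3 + 2 * N%:R * ka^-1) / (4 * ka).
have ik0 : 0 < ka^-1 by rewrite invr_gt0.
have Nk0 : 0 <= N%:R * ka^-1 by rewrite mulr_ge0// ltW.
have num0 : 0 < ka^-1 + 3 + 2 * N%:R * ka^-1.
  by move: ik0 Nk0; clear; lra.
have quo0 : 0 < (ka^-1 + 3 + 2 * N%:R * ka^-1) / (4 * ka).
  by rewrite divr_gt0// mulr_gt0.
have [K1 rK r2K hK] : [/\ 1 <= K, r <= K, 2 * r ^+ 2 <= K &
    ka^-1 + 3 + 2 * N%:R * ka^-1 <= 4 * ka * K].
  have r20 : 0 <= 2 * r ^+ 2 by rewrite mulr_ge0 ?sqr_ge0.
  have h4 : (ka^-1 + 3 + 2 * N%:R * ka^-1) / (4 * ka) <= K.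
    by rewrite /K lerDr; apply: addr_ge0 => //; apply: addr_ge0 => //; exact: ltW.
  have [? ? ?] : [/\ 1 <= K, r <= K & 2 * r ^+ 2 <= K].
    rewrite /K; move: (_ / (4 * ka)) quo0 => c c0.
    by split; move: r0 r20 c0; clear; lra.
  by split => //; rewrite [leRHS]mulrC -ler_pdivrMr ?mulr_gt0.
have K0 : 0 < K by exact: lt_le_trans K1.
(* Where [rho] is positive, times stay within [t0 / 2] of [t0], away from the initial time, and
   positions within distance 1 of [x0]. *)
pose b : R := Num.min (t0 / 2) 1.
have b0 : 0 < b by rewrite lt_min ltr01 divr_gt0.
have b1 : b <= 1 by rewrite ge_min lexx orbT.
have bt : b <= t0 / 2 by rewrite ge_min lexx.
have b21 : b ^+ 2 <= 1 by rewrite expr_le1// ltW.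
exists b, K; split => // i1 x1 z1 l /andP[l0 l1] y1 hy1.
rewrite leNgt; apply/negP => hlt.
have l1' : 0 < 1 - l by rewrite subr_gt0.
pose mu : R := l * (1 - l).
have mu0 : 0 < mu by rewrite mulr_gt0.
pose rho (w : R * 'rV[R]_N) : R := b ^+ 2 - (w.1 - t0) ^+ 2 - sq (w.2 - x0).
have rho1 : rho (t0, y1) = b ^+ 2 - sq (y1 - x0).
  by rewrite /rho /= subrr expr0n subr0.
pose M : R := l * ext u i1 (t0, x1) + (1 - l) * ext u i1 (t0, z1)
  - ext u i1 (t0, y1) - mu * sq (x1 - z1) * K / rho (t0, y1).
have M0 : 0 < M by rewrite /M rho1 /mu subr_gt0.
have [d d0 hd] := sol_unif hu T0 M0.
(* If [sq (x - z)] were below [eta], the three values of [u] would be too close for [Phi] to reach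
   [M]. Hence a lower bound on [X] that does not depend on [e]. *)
pose eta : R := (d / 2) ^+ 2.
have eta0 : 0 < eta by rewrite exprn_gt0// divr_gt0.
have C0 : 0 < C by exact: lt_le_trans C1.
(* At a maximum [X * K / rho] is at most [2 * C] and [X] at least [mu * eta], so [rho] exceeds the
   first entry; the second keeps the starting point admissible. *)
pose sg : R := Num.min (mu * eta * K / (4 * C)) (rho (t0, y1)).
have sg0 : 0 < sg.
  by rewrite lt_min rho1 subr_gt0 hy1 andbT divr_gt0// !mulr_gt0.
have c0 : 0 <= 2 * C + r + ka^-1 * N%:R * r.
  rewrite !addr_ge0//; [by rewrite mulr_ge0// ltW|exact: ltW|].
  by rewrite !mulr_ge0 ?(ltW ik0) ?(ltW r0).
have t40 : 0 < (t0 / 4) ^+ 2 by rewrite exprn_gt0// divr_gt0.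
have d20 : 0 < d ^+ 2 by rewrite exprn_gt0.
have [|e e0 he] := small_eps (s := [:: l * (t0 / 4) ^+ 2; (1 - l) * (t0 / 4) ^+ 2;
  l * d ^+ 2; (1 - l) * d ^+ 2; eta; 1; mu * eta]) c0.
  by apply/allP; rewrite /= ltr01 eta0 !mulr_gt0.
have Cer : 0 <= C * e by rewrite mulr_ge0 ?(ltW e0) ?(ltW C0).
have rer : 0 <= r * e by rewrite mulr_ge0 ?(ltW e0) ?(ltW r0).
have ker : 0 <= ka^-1 * N%:R * r * e.
  by rewrite !mulr_ge0 ?(ltW ik0) ?(ltW r0) ?(ltW e0).
have heC a : a \in [:: l * (t0 / 4) ^+ 2; (1 - l) * (t0 / 4) ^+ 2;
  l * d ^+ 2; (1 - l) * d ^+ 2; eta; 1; mu * eta] -> 2 * C * e < a.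
  by move/he; move: Cer rer ker; clear; move: (ka^-1 * N%:R) => *; lra.
have he1 : 2 * C * e < l * (t0 / 4) ^+ 2 by apply: heC; rewrite !inE eqxx ?orbT.
have he2 : 2 * C * e < (1 - l) * (t0 / 4) ^+ 2.
  by apply: heC; rewrite !inE eqxx ?orbT.
have he3 : 2 * C * e < l * d ^+ 2 by apply: heC; rewrite !inE eqxx ?orbT.
have he4 : 2 * C * e < (1 - l) * d ^+ 2 by apply: heC; rewrite !inE eqxx ?orbT.
have he5 : 2 * C * e < eta by apply: heC; rewrite !inE eqxx ?orbT.
have he51 : 2 * C * e < 1 by apply: heC; rewrite !inE eqxx ?orbT.
have he6 : e * r <= 1.
  have : (2 * C + r + ka^-1 * N%:R * r) * e < 1.
    by apply: he; rewrite !inE eqxx ?orbT.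
  by move: Cer rer ker; clear; move: (ka^-1 * N%:R) => *; lra.
have he7 : ka^-1 * N%:R * r * e < mu * eta.
  have : (2 * C + r + ka^-1 * N%:R * r) * e < mu * eta.
    by apply: he; rewrite !inE eqxx ?orbT.
  by move: Cer rer; clear; move: (ka^-1 * N%:R) => *; lra.
clear he heC.
(* Bounds the coordinates of [x - z]; adding 1 passes from the square to the length without a square
   root. *)
pose D : R := 2 * C / mu + 1.
have D0 : 0 <= 2 * C / mu by rewrite divr_ge0 ?mulr_ge0 ?ltW.
pose rad : R := D + 3 + `|x1 - x0| + `|z1 - x0|.
pose K3 := [set w : R * 'rV[R]_N | (`[t0 - 1, t0 + 1] `*` box x0 1) w /\ sg <= rho w].
(* The times [t] and [s] end up within [t0 / 4] of a time that is within [t0 / 2] of [t0]. *)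
pose K1' := `[t0 / 4, 7 * t0 / 4] `*` box x0 rad.
pose KK := (K1' `*` K1') `*` K3.
have crho : continuous rho.
  apply: contB; first apply: contB; first exact: cont_cst.
    by apply: contX2; apply: contB; [exact: cont_fst|exact: cont_cst].
  by apply: continuous_sq; apply: contBv; [exact: cont_snd|exact: cont_cst].
have cK3 : compact K3.
  apply: (@compact_closedI _ _ (rho @^-1` [set a | sg <= a])).
    exact: compact_cylinder.
  by apply: closed_comp => [w _|]; [exact: crho|exact: closed_ge].
have cKK : compact KK.
  by apply: compact_setX cK3; apply: compact_setX; exact: compact_cylinder.
pose W := ((R * 'rV[R]_N) * (R * 'rV[R]_N) * (R * 'rV[R]_N))%type.
pose E (t s r' : R) (x z y : 'rV[R]_N) : R :=
  sq (l *: x + (1 - l) *: z - y) + l * (t - r') ^+ 2 + (1 - l) * (s - r') ^+ 2.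
(* Truncating at [sg] makes the weight continuous everywhere without changing it on [KK]. *)
pose Phi i (w : W) : R :=
  l * ext u i w.1.1 + (1 - l) * ext u i w.1.2 - ext u i w.2
  - mu * sq (w.1.1.2 - w.1.2.2) * K / Num.max sg (rho w.2)
  - e^-1 * E w.1.1.1 w.1.2.1 w.2.1 w.1.1.2 w.1.2.2 w.2.2.
have cPhi i : continuous (Phi i).
  have c11 : continuous (fun w : W => w.1.1) by apply: cont_comp; exact: cont_fst.
  have c12 : continuous (fun w : W => w.1.2).
    by apply: cont_comp; [exact: cont_fst|exact: cont_snd].
  have c2 : continuous (fun w : W => w.2) by exact: cont_snd.
  have cf (f : W -> R * 'rV[R]_N) : continuous f -> continuous (fun w => (f w).1).
    by move=> c; apply: (cont_comp c); exact: cont_fst.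
  have cs (f : W -> R * 'rV[R]_N) : continuous f -> continuous (fun w => (f w).2).
    by move=> c; apply: (cont_comp c); exact: cont_snd.
  have cu (f : W -> R * 'rV[R]_N) : continuous f -> continuous (fun w => ext u i (f w)).
    by move=> c; apply: (cont_comp c); exact: (ext_continuous hu).
  have ck (a : R) (f : W -> R) : continuous f -> continuous (fun w => a * f w).
    by move=> c; apply: contM => //; exact: cont_cst.
  have cx : continuous (fun w : W => w.1.1.2) by exact: (cs _ c11).
  have cz : continuous (fun w : W => w.1.2.2) by exact: (cs _ c12).
  have cy : continuous (fun w : W => w.2.2) by exact: (cs _ c2).
  have clx : continuous (fun w : W => l *: w.1.1.2) by exact: (@contZv R W _ l _ cx).
  have clz : continuous (fun w : W => (1 - l) *: w.1.2.2) by exact: (@contZv R W _ (1 - l) _ cz).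
  have cE : continuous (fun w : W =>
      e^-1 * E w.1.1.1 w.1.2.1 w.2.1 w.1.1.2 w.1.2.2 w.2.2).
    have h1 := continuous_sq (contBv (contDv clx clz) cy).
    have h2 := ck l _ (contX2 (contB (cf _ c11) (cf _ c2))).
    have h3 := ck (1 - l) _ (contX2 (contB (cf _ c12) (cf _ c2))).
    exact: (ck e^-1 _ (contD (contD h1 h2) h3)).
  have cm : continuous (fun w : W => (Num.max sg (rho w.2))^-1).
    apply: contV => [w|]; first by rewrite gt_eqF// lt_max sg0.
    move=> w; apply: (@continuous_max _ _ (cst sg) (fun w : W => rho w.2)).
      exact: cvg_cst.
    exact: (cont_comp c2 crho).
  have cq := contM (contM (ck mu _ (continuous_sq (contBv cx cz)))
    (@cont_cst _ _ K)) cm.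
  have cv := contB (contD (ck l _ (cu _ c11)) (ck (1 - l) _ (cu _ c12))) (cu _ c2).
  exact: (contB (contB cv cq) cE).
have PK : KK ((t0, x1), (t0, z1), (t0, y1)).
  have tK : t0 / 4 <= t0 <= 7 * t0 / 4.
    by apply/andP; split; move: t00; clear; lra.
  split; [split; split => /=|split; [split => /=|]].
  - by rewrite in_itv.
  - move=> j; have := coord_le_norm (x1 - x0) 0 j; rewrite !mxE => /le_trans; apply.
    rewrite /rad /D; move: D0 (normr_ge0 (z1 - x0)); clear; lra.
  - by rewrite in_itv.
  - move=> j; have := coord_le_norm (z1 - x0) 0 j; rewrite !mxE => /le_trans; apply.
    rewrite /rad /D; move: D0 (normr_ge0 (x1 - x0)); clear; lra.
  - by rewrite in_itv/= gerBl lerDl ler01.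
  - move=> j; have := @coord_le_sq _ _ (y1 - x0) 1 j ler01; rewrite !mxE; apply.
    by rewrite expr1n (le_trans _ b21)// ltW.
  - by rewrite /= ge_min lexx orbT.
have [i [[[[t x] [s z]] [q y]] [[/= [[/= tK xK] [/= sK zK]] [[/= qK yK] rsg]] hmax]]] :=
  @max_family R _ _ KK Phi i1 (ex_intro _ _ PK) cKK cPhi.
move: tK sK qK; rewrite !in_itv /= => tK sK qK.
have Phi1 : M <= Phi i ((t, x), (s, z), (q, y)).
  apply: le_trans (hmax i1 _ PK); rewrite /Phi /= max_r; last first.
    by rewrite ge_min lexx orbT.
  by rewrite /E !subrr sq0 expr0n !mulr0 !addr0 mulr0 subr0.

(* Location of the maximum point *)
pose rh := rho (q, y).
have rh0 : 0 < rh by exact: lt_le_trans rsg.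
have PhiE j w : KK w -> Phi j w = l * ext u j w.1.1 + (1 - l) * ext u j w.1.2 - ext u j w.2
    - mu * sq (w.1.1.2 - w.1.2.2) * K / rho w.2
    - e^-1 * E w.1.1.1 w.1.2.1 w.2.1 w.1.1.2 w.1.2.2 w.2.2.
  by case=> _ [_ hw]; rewrite /Phi max_r.
have KKm : KK ((t, x), (s, z), (q, y)).
  by split; [split; split => //=; rewrite in_itv|split => //; split => //=; rewrite in_itv].
pose X : R := mu * sq (x - z).
have X0 : 0 <= X by rewrite mulr_ge0 ?sq_ge0 ?(ltW mu0).
have Phi2 := Phi1; rewrite PhiE//= -/rh -/X in Phi2.
have XK0 : 0 <= X * K / rh.
  by apply: divr_ge0; [apply: mulr_ge0 => //; exact: ltW|exact: ltW].
have E1 : 0 <= sq (l *: x + (1 - l) *: z - y) by exact: sq_ge0.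
have E2 : 0 <= l * (t - q) ^+ 2 by rewrite mulr_ge0 ?sqr_ge0 ?(ltW l0).
have E3 : 0 <= (1 - l) * (s - q) ^+ 2 by rewrite mulr_ge0 ?sqr_ge0 ?(ltW l1').
have E0 : 0 <= E t s q x z y by rewrite /E !addr_ge0.
have ie0 : 0 < e^-1 by rewrite invr_gt0.
have eE0 : 0 <= e^-1 * E t s q x z y by rewrite mulr_ge0 ?(ltW ie0).
have rt : (q - t0) ^+ 2 < b ^+ 2.
  by move: rh0 (sq_ge0 (y - x0)); rewrite /rh /rho /=; clear; lra.
have yx : sq (y - x0) < b ^+ 2.
  by move: rh0 (sqr_ge0 (q - t0)); rewrite /rh /rho /=; clear; lra.
have rh1 : rh <= 1.
  apply: le_trans b21; rewrite /rh /rho /=.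
  by move: (sq_ge0 (y - x0)) (sqr_ge0 (q - t0)); clear; lra.
have qt : `|q - t0| < b by exact: ltr_norm_sqr.
have qpos : 0 < q < 2 * t0.
  move: qt bt t00; rewrite ltr_distl => /andP[h1 h2] h3 h4.
  by apply/andP; split; move: h1 h2 h3 h4; clear; lra.
have inT a : t0 / 4 <= a <= 7 * t0 / 4 -> 0 <= a <= 2 * t0.
  by move=> /andP[h1 h2]; apply/andP; split; move: t00 h1 h2; clear; lra.
have vC a w : 0 <= a <= 2 * t0 -> - C <= ext u i (a, w) <= C.
  by move=> aT; have := hC i a w aT; rewrite ler_norml.
have q0T : 0 <= q <= 2 * t0 by case/andP: qpos => h1 h2; rewrite !ltW.
have w2C : l * ext u i (t, x) + (1 - l) * ext u i (s, z) - ext u i (q, y) <= 2 * C.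
  have /andP[_ h1] := vC t x (inT _ tK).
  have /andP[_ h2] := vC s z (inT _ sK).
  have /andP[h3 _] := vC q y q0T.
  have h4 := ler_wpM2l (ltW l0) h1; have h5 := ler_wpM2l (ltW l1') h2.
  by move: h3 h4 h5; clear; lra.
have hX : X * K / rh <= 2 * C.
  by move: Phi2 w2C eE0 M0; clear; move: (e^-1 * _) (X * K / rh) => *; lra.
have hE : E t s q x z y <= 2 * C * e.
  rewrite mulrC -ler_pdivrMl//.
  by move: Phi2 w2C XK0 M0; clear; move: (e^-1 * _) (X * K / rh) => *; lra.
have cy2 : sq (l *: x + (1 - l) *: z - y) <= 2 * C * e.
  by move: hE E2 E3; rewrite /E; clear; lra.
have tq2 : l * (t - q) ^+ 2 <= 2 * C * e.
  by move: hE E1 E3; rewrite /E; clear; lra.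
have sq2 : (1 - l) * (s - q) ^+ 2 <= 2 * C * e.
  by move: hE E1 E2; rewrite /E; clear; lra.
have tq4 : `|t - q| < t0 / 4.
  apply: ltr_norm_sqr; first by rewrite divr_gt0.
  by rewrite -(ltr_pM2l l0); exact: le_lt_trans he1.
have sq4 : `|s - q| < t0 / 4.
  apply: ltr_norm_sqr; first by rewrite divr_gt0.
  by rewrite -(ltr_pM2l l1'); exact: le_lt_trans he2.
have tqd : `|t - q| < d.
  by apply: ltr_norm_sqr => //; rewrite -(ltr_pM2l l0); exact: le_lt_trans he3.
have sqd : `|s - q| < d.
  by apply: ltr_norm_sqr => //; rewrite -(ltr_pM2l l1'); exact: le_lt_trans he4.
have tint : t0 / 4 < t < 7 * t0 / 4.
  move: tq4 qt bt; rewrite !ltr_distl => /andP[h1 h2] /andP[h3 h4] h5.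
  by apply/andP; split; move: h1 h2 h3 h4 h5; clear; lra.
have sint : t0 / 4 < s < 7 * t0 / 4.
  move: sq4 qt bt; rewrite !ltr_distl => /andP[h1 h2] /andP[h3 h4] h5.
  by apply/andP; split; move: h1 h2 h3 h4 h5; clear; lra.
have d20' : 0 < d / 2 by rewrite divr_gt0.
have cyd j : `|(l *: x + (1 - l) *: z - y) 0 j| < d / 2.
  by apply: coord_lt_sq => //; exact: le_lt_trans he5.
have Xeta : eta <= sq (x - z).
  rewrite leNgt; apply/negP => hxz.
  have xzj j : `|(x - z) 0 j| < d / 2 by exact: coord_lt_sq.
  have xy j : `|x 0 j - y 0 j| < d.
    have -> : x 0 j - y 0 j = (l *: x + (1 - l) *: z - y) 0 j
      + (1 - l) * (x - z) 0 j by rewrite !mxE; ring.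
    apply: (le_lt_trans (ler_normD _ _)); rewrite (splitr d); apply: ltrD => //.
    rewrite normrM gtr0_norm//; apply: le_lt_trans (xzj j).
    by rewrite ler_piMl// gerBl ltW.
  have zy j : `|z 0 j - y 0 j| < d.
    have -> : z 0 j - y 0 j = (l *: x + (1 - l) *: z - y) 0 j
      - l * (x - z) 0 j by rewrite !mxE; ring.
    apply: (le_lt_trans (ler_normB _ _)); rewrite (splitr d); apply: ltrD => //.
    rewrite normrM gtr0_norm//; apply: le_lt_trans (xzj j).
    by rewrite ler_piMl// ltW.
  have := hd i t q x y (inT _ tK) q0T tqd xy.
  have := hd i s q z y (inT _ sK) q0T sqd zy.
  rewrite !ltr_norml => /andP[_ h1] /andP[_ h2].
  rewrite -(ltr_pM2l l1') in h1; rewrite -(ltr_pM2l l0) in h2.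
  by move: Phi2 XK0 eE0 h1 h2; clear; move: (e^-1 * _) (X * K / rh) => *; lra.
(* The constraint [sg <= rho] is not active at the maximum, so [(q, y)] may be perturbed freely. *)
have rsg' : sg < rh.
  apply: (@le_lt_trans _ _ (mu * eta * K / (4 * C))); first by rewrite ge_min lexx.
  rewrite ltr_pdivrMr ?mulr_gt0//.
  rewrite ler_pdivrMr// in hX.
  have h1 : mu * eta * K <= X * K by rewrite ler_pM2r// ler_pM2l.
  have h2 : 0 < C * rh by rewrite mulr_gt0.
  by move: h1 h2 hX; clear; lra.
have X2C : X <= 2 * C.
  apply: le_trans hX; rewrite ler_pdivlMr//.
  apply: (@le_trans _ _ (X * 1)); first by rewrite ler_wpM2l.
  by rewrite ler_wpM2l.
have xzD j : `|(x - z) 0 j| <= D.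
  apply: coord_le_sq; first by rewrite addr_ge0.
  apply: le_trans (le_sqr_add1 D0).
  by rewrite ler_pdivlMr// mulrC.
have cy1 j : `|(l *: x + (1 - l) *: z - y) 0 j| <= 1.
  by apply: coord_le_sq => //; rewrite expr1n (le_trans cy2)// ltW.
have yj j : `|y 0 j - x0 0 j| <= 1 := yK j.
have radD : D + 3 <= rad.
  by rewrite /rad; move: (normr_ge0 (x1 - x0)) (normr_ge0 (z1 - x0)); clear; lra.
have xrad j : `|x 0 j - x0 0 j| < rad.
  have -> : x 0 j - x0 0 j = (l *: x + (1 - l) *: z - y) 0 j
    + (1 - l) * (x - z) 0 j + (y 0 j - x0 0 j) by rewrite !mxE; ring.
  have h1 : `|(1 - l) * (x - z) 0 j| <= D.
    rewrite normrM gtr0_norm//; apply: le_trans (xzD j).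
    by rewrite ler_piMl// gerBl ltW.
  have := ler_normD ((l *: x + (1 - l) *: z - y) 0 j + (1 - l) * (x - z) 0 j)
    (y 0 j - x0 0 j).
  have := ler_normD ((l *: x + (1 - l) *: z - y) 0 j) ((1 - l) * (x - z) 0 j).
  by move: (cy1 j) (yj j) h1 radD; clear; lra.
have zrad j : `|z 0 j - x0 0 j| < rad.
  have -> : z 0 j - x0 0 j = (l *: x + (1 - l) *: z - y) 0 j
    - l * (x - z) 0 j + (y 0 j - x0 0 j) by rewrite !mxE; ring.
  have h1 : `|l * (x - z) 0 j| <= D.
    rewrite normrM gtr0_norm//; apply: le_trans (xzD j).
    by rewrite ler_piMl// ltW.
  have := ler_normD ((l *: x + (1 - l) *: z - y) 0 j - l * (x - z) 0 j)
    (y 0 j - x0 0 j).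
  have := ler_normB ((l *: x + (1 - l) *: z - y) 0 j) (l * (x - z) 0 j).
  by move: (cy1 j) (yj j) h1 radD; clear; lra.
have yb j : `|y 0 j - x0 0 j| < 1.
  have := @coord_lt_sq _ _ (y - x0) 1 j ltr01; rewrite !mxE expr1n; apply.
  exact: lt_le_trans b21.
have qb : t0 - 1 < q < t0 + 1 by rewrite -ltr_distl; exact: lt_le_trans b1.
have tpos : 0 < t by case/andP: tint => h _; apply: lt_trans h; rewrite divr_gt0.
have spos : 0 < s by case/andP: sint => h _; apply: lt_trans h; rewrite divr_gt0.

(* Viscosity inequalities at the three points *)
pose G : R := K / rh.
have G0 : 0 < G by rewrite divr_gt0.
have XG : X * K / rh = mu * G * sq (x - z) by rewrite /X /G; ring.
have ll : 0 < l <= 1 by rewrite l0 ltW.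
have ll' : 0 < 1 - l <= 1 by rewrite l1' gerBl ltW.
have J1 : \forall w \near (t, x),
     l * ext u i w - l * (1 - l) * G * sq (w.2 - z)
       - e^-1 * (sq (l *: w.2 + (1 - l) *: z - y) + l * (w.1 - q) ^+ 2) <=
     l * ext u i (t, x) - l * (1 - l) * G * sq (x - z)
       - e^-1 * (sq (l *: x + (1 - l) *: z - y) + l * (t - q) ^+ 2).
  near=> w.
  have wK : KK (w, (s, z), (q, y)).
    have [h1 h2] : t0 / 4 <= w.1 <= 7 * t0 / 4 /\ box x0 rad w.2.
      by near: w; exact: near_cylinder.
    by case: KKm => -[_ ?] ?; split => //; split => //; split => //=; rewrite in_itv.
  have := hmax i _ wK; rewrite !PhiE//= -/rh /E /mu /G.
  have -> (a : R) : l * (1 - l) * a * K / rh = l * (1 - l) * (K / rh) * a by ring.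
  have -> (a : R) : l * (1 - l) * a * K / rh = l * (1 - l) * (K / rh) * a by ring.
  clear; move: (K / rh) (sq _) (sq _) (sq _) (sq _) => *; lra.
have J2 : \forall w \near (s, z),
     (1 - l) * ext u i w - (1 - l) * (1 - (1 - l)) * G * sq (w.2 - x)
       - e^-1 * (sq ((1 - l) *: w.2 + (1 - (1 - l)) *: x - y) + (1 - l) * (w.1 - q) ^+ 2) <=
     (1 - l) * ext u i (s, z) - (1 - l) * (1 - (1 - l)) * G * sq (z - x)
       - e^-1 * (sq ((1 - l) *: z + (1 - (1 - l)) *: x - y) + (1 - l) * (s - q) ^+ 2).
  near=> w.
  have wK : KK ((t, x), w, (q, y)).
    have [h1 h2] : t0 / 4 <= w.1 <= 7 * t0 / 4 /\ box x0 rad w.2.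
      by near: w; exact: near_cylinder.
    by case: KKm => -[? _] ?; split => //; split => //; split => //=; rewrite in_itv.
  have := hmax i _ wK; rewrite !PhiE//= -/rh /E /mu /G.
  have -> (a : 'rV[R]_N) : (1 - l) *: a + (1 - (1 - l)) *: x = l *: x + (1 - l) *: a.
    by rewrite addrC; congr (_ *: _ + _); ring.
  have -> (a : 'rV[R]_N) : (1 - l) *: a + (1 - (1 - l)) *: x = l *: x + (1 - l) *: a.
    by rewrite addrC; congr (_ *: _ + _); ring.
  rewrite -(sqN (w.2 - x)) -(sqN (z - x)) !opprB.
  have -> (a : R) : l * (1 - l) * a * K / rh = l * (1 - l) * (K / rh) * a by ring.
  have -> (a : R) : l * (1 - l) * a * K / rh = l * (1 - l) * (K / rh) * a by ring.
  clear; move: (K / rh) (sq _) (sq _) (sq _) (sq _) => *; lra.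
have J3 : \forall w \near (q, y), sg <= rho w /\
     - ext u i w - X * K / rho w
       - e^-1 * (sq (l *: x + (1 - l) *: z - w.2) + l * (t - w.1) ^+ 2
         + (1 - l) * (s - w.1) ^+ 2) <=
     - ext u i (q, y) - X * K / rho (q, y)
       - e^-1 * (sq (l *: x + (1 - l) *: z - y) + l * (t - q) ^+ 2
         + (1 - l) * (s - q) ^+ 2).
  near=> w.
  have sw : sg <= rho w by apply: ltW; near: w; exact: (near_gt crho rsg').
  split => //.
  have wK : KK ((t, x), (s, z), w).
    have [h1 h2] : t0 - 1 <= w.1 <= t0 + 1 /\ box x0 1 w.2.
      by near: w; exact: near_cylinder.
    by case: KKm => ? _; split => //; split => //; split => //=; rewrite in_itv.
  have := hmax i _ wK; rewrite !PhiE//= /E -/X.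
  clear; move: (X * K / rho w) (X * K / _) (e^-1 * _) (e^-1 * _) => *; lra.
have {}J1 := touch_upper ll G0 e0 J1.
have {}J2 := touch_upper ll' G0 e0 J2.
have l01 : 0 <= l <= 1 by rewrite !ltW.
have XK0' : 0 <= X * K by apply: mulr_ge0 => //; exact: ltW.
have {}J3 := touch_lower l01 XK0' e0 sg0 b21 rh0 J3.
have slope (a c : R) (w p : 'rV[R]_N) : 0 < a < 2 * t0 -> forall M',
    (\forall z \near (a, w), ext u i z <= ext u i (a, w) + quad_test a w c M' p z) ->
    - A <= c.
  move=> /andP[a0 aT] M'; apply: slope_ge.
  have cid : continuous (fun a : R => a) by move=> a'; exact: cvg_id.
  near=> a'; apply: hA; first by rewrite !ltW.
  have a'0 : 0 < a' by near: a'; exact: (near_gt cid a0).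
  have a'T : a' < 2 * t0.
    by near: a'; exact: (near_lt cid aT).
  by rewrite !ltW.
have intT a : t0 / 4 < a < 7 * t0 / 4 -> 0 < a < 2 * t0.
  by move=> /andP[h1 h2]; apply/andP; split; move: t00 h1 h2; clear; lra.
have sl1 := slope _ _ _ _ (intT _ tint) _ J1.
have sl2 := slope _ _ _ _ (intT _ sint) _ J2.
have q0 : 0 < q by case/andP: qpos.
have sub1 := ext_sub_jet hu tpos J1.
have sub2 := ext_sub_jet hu spos J2.
have sup := ext_super_jet hu q0 J3.
set px := _ + _ *: (x - z) in sub1.
set pz := _ + _ *: (z - x) in sub2.
set py := _ - _ *: (y - x0) in sup.
have hpx : sq px <= r ^+ 2.
  apply: (hr i x); have := hCb i t x (inT _ tK); rewrite ler_norml => /andP[h _].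
  by move: sub1 sl1 h; clear; lra.
have hpz : sq pz <= r ^+ 2.
  apply: (hr i z); have := hCb i s z (inT _ sK); rewrite ler_norml => /andP[h _].
  by move: sub2 sl2 h; clear; lra.
have cpl : 0 <= \sum_j B i j * (l * ext u j (t, x) + (1 - l) * ext u j (s, z)
    - ext u j (q, y)).
  apply: (@coupling_max _ _ _ (fun j => l * ext u j (t, x)
    + (1 - l) * ext u j (s, z) - ext u j (q, y))) => // j.
  by have := hmax j _ KKm; rewrite !PhiE//=; clear; lra.
have {}cpl : \sum_j B i j * ext u j (q, y) <=
    l * \sum_j B i j * ext u j (t, x) + (1 - l) * \sum_j B i j * ext u j (s, z).
  rewrite -subr_ge0 !mulr_sumr -big_split -sumrB; apply: le_trans cpl _.
  by apply: ler_sum => j _ /=; rewrite le_eqVlt; apply/orP; left; apply/eqP; ring.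
have pzE : pz = (2 / e) *: (l *: x + (1 - l) *: z - y) + (2 * G * l) *: (z - x).
  by rewrite /pz; apply/rowP => j; rewrite !mxE; ring.
have yx1 : sq (y - x0) <= 1 by apply: le_trans b21; exact: ltW.
have tau1 : `|t0 - q| <= 1 by rewrite distrC (le_trans (ltW qt)).
have rh01 : 0 < rh <= 1 by rewrite rh0.
have l01' : 0 < l < 1 by rewrite l0.
have hpz' := hpz; rewrite pzE in hpz'.
(* In the combination with weights [l], [1 - l] and [- 1], the slopes of size [2 / e] cancel and
   only the time derivative of the weight remains. *)
have main : l * H i x px + (1 - l) * H i z pz - H i y py <=
    2 * (X * K) / rh ^+ 2 * (t0 - q).
  rewrite -(pmulr_rle0 _ l0) in sub1; rewrite -(pmulr_rle0 _ l1') in sub2.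
  move: sub1 sub2 sup cpl; rewrite -/rh; clear.
  move: (2 * (X * K) / rh ^+ 2) (2 / e) => c1 c2.
  move: (H i x px) (H i z pz) (H i y py) (\sum_j _) (\sum_j _) (\sum_j _) => *; lra.
rewrite pzE in main.
have := semiconcavity_gain ka0 (hka i) r0 K1 rK r2K hK rh01 l01' e0 he6 yx1 tau1
  (erefl _) hpx hpz' main.
rewrite -/mu -/X => hfin.
(* The bound of order [e] on [X] falls below the fixed lower bound by [he7]. *)
have : mu * eta <= X by rewrite ler_pM2l.
by move: hfin he7; clear; move: (ka^-1 * _ * _ * _) => *; lra.
Unshelve. all: by end_near.
Qed.

Lemma sq_conv (R : realType) n (x y : 'rV[R]_n) (a : R) :
  sq (a *: x + (1 - a) *: y) =
  a * sq x + (1 - a) * sq y - a * (1 - a) * sq (x - y).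
Proof. by rewrite [LHS]sqD !sqZ dotZl dotZr (sqB x); ring. Qed.

Theorem theorem7p9 (R : realType) (N m : nat) (hN : (1 <= N)%N)
    (hm : (1 <= m)%N)
    (H : 'I_m -> 'rV[R]_N -> 'rV[R]_N -> R) (B : 'M[R]_m)
    (hH : standing_hamiltonians H)
    (hB : coupling_matrix B)
    (hH2 : forall i : 'I_m,
      class_C 2 setT (fun z : 'rV[R]_N * 'rV[R]_N => H i z.1 z.2))
    (hHpp : forall (i : 'I_m) (x p : 'rV[R]_N), posdef (hessian (H i x) p))
    (u0 : 'rV[R]_N -> 'cV[R]_m)
    (hu0b : [bounded u0 x | x in [set: 'rV[R]_N]])
    (hu0l : lipschitz u0)
    (u : R * 'rV[R]_N -> 'cV[R]_m)
    (hu : is_cauchy_solution H B u0 u) :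
  forall t : R, 0 < t ->
  forall i : 'I_m, locally_semiconcave (fun x => u (t, x) i 0).
Proof.
move=> t t0 i x0.
have [b [K [b0 K0 hK]]] := semiconcave_weighted x0 hN hH hB hH2 hHpp hu0l hu t0.
have b20 : 0 < b ^+ 2 by rewrite exprn_gt0.
have C0 : 0 < 2 * K / b ^+ 2 by rewrite divr_gt0// mulr_gt0.
(* On this ball the denominator of the weighted estimate is at least [b ^+ 2 / 2], whence the
   constant [2 * K / b ^+ 2]. *)
pose U := [set x : 'rV[R]_N | sq (x - x0) < b ^+ 2 / 2].
have Uconv x y a : U x -> U y -> 0 <= a <= 1 -> U (a *: x + (1 - a) *: y).
  move=> /= Ux Uy /andP[a0 a1].
  rewrite /U /= (_ : _ - x0 = a *: (x - x0) + (1 - a) *: (y - x0)); last first.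
    by apply/rowP => j; rewrite !mxE; ring.
  rewrite sq_conv; set X := sq (x - x0); set Y := sq (y - x0).
  have h1 : X <= Num.max X Y by rewrite le_max lexx.
  have h2 : Y <= Num.max X Y by rewrite le_max lexx orbT.
  apply: (@le_lt_trans _ _ (Num.max X Y)); last by rewrite gt_max Ux Uy.
  have a1' : 0 <= 1 - a by rewrite subr_ge0.
  have h3 : 0 <= a * (1 - a) * sq ((x - x0) - (y - x0)).
    by rewrite mulr_ge0 ?sq_ge0// mulr_ge0.
  have := ler_wpM2l a0 h1; have := ler_wpM2l a1' h2.
  by move: h3; clear; lra.
exists U, (2 * K / b ^+ 2); split => //.
- split; last by rewrite /U /= subrr sq0 divr_gt0.
  rewrite /U (_ : [set _ | _] = (fun x => sq (x - x0)) @^-1` [set a | a < b ^+ 2 / 2])//.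
  apply: open_comp => [x _|]; last exact: open_lt.
  have cid : continuous (fun x : 'rV[R]_N => x) by move=> z; exact: cvg_id.
  exact: (continuous_sq (contBv cid (@cont_cst _ _ x0))).
- move=> x y k; rewrite !inE => Ux Uy; apply: Uconv => //.
  by apply/andP; split; [exact: ge0|exact: le1].
move=> x y a Ux Uy /[dup] a01 /andP[a0 a1].
rewrite -!(extE (u := u) _ _ (ltW t0)) enorm_sq.
have CX : 0 <= 2 * K / b ^+ 2 * sq (x - y) by rewrite mulr_ge0 ?sq_ge0// ltW.
(* The weighted estimate is for weights strictly between 0 and 1; at the ends the inequality is
   trivial. *)
have [->|an0] := eqVneq a 0.
  by rewrite subr0 !scale0r !add0r scale1r mul0r add0r mul1r gerBl.
have [->|an1] := eqVneq a 1.
  by rewrite subrr scale0r addr0 scale1r mul0r addr0 mul1r gerBl.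
have a01' : 0 < a < 1 by rewrite !lt_neqAle eq_sym an0 a0 an1.
have Uz := Uconv x y a Ux Uy a01; rewrite /U /= in Uz.
have z2 : b ^+ 2 / 2 <= b ^+ 2 - sq (a *: x + (1 - a) *: y - x0).
  by move: Uz; clear; lra.
have zb : sq (a *: x + (1 - a) *: y - x0) < b ^+ 2.
  by move: Uz b20; clear; lra.
have := hK i x y a a01' zb; move=> hle; rewrite lerBlDr -lerBlDl; apply: (le_trans hle).
rewrite ler_pdivrMr; last by apply: lt_le_trans z2; rewrite divr_gt0.
have aa : a * (1 - a) <= 1.
  by have := mulr_ge0 a0 a0; move: a1; clear; nra.
have s0 := sq_ge0 (x - y).
have h1 : a * (1 - a) * sq (x - y) * K <= sq (x - y) * K.
  by rewrite ler_pM2r// ler_piMl.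
apply: (le_trans h1).
have -> : sq (x - y) * K = 2 * K / b ^+ 2 * sq (x - y) * (b ^+ 2 / 2).
  by field; rewrite gt_eqF.
by rewrite ler_wpM2l.
Qed.
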